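(* Let $H$ be a (separable) Hilbert space, $T>0$, and $V_j\colon[0,T]\times H\to H$, $j=0,\dots,d$. Suppose that the cubature formula used in the definition of $Q^t_{(\Delta t)}$ is weakly symmetric. Let $\psi$ be an admissible weight function on $H$ (twice differentiable) and suppose that with some constant $C>0$, for all $x\in H$, $$\lVert D\psi(x)\rVert\le C(1+\lVert x\rVert^2)^{-1/2}\psi(x)\quad\text{and}\quad\lVert D^2\psi(x)\rVert\le C(1+\lVert x\rVert^2)^{-1}\psi(x).$$ Furthermore, assume that for some constant $C>0$ independent of $t$, $$\lVert V_j(t,x)\rVert\le C(1+\lVert x\rVert^2)^{1/2}\quad\text{for } j=0,\dots,d,\ x\in H,\ t\in[0,T],$$ and that $x\mapsto V_j(t,x)$ is continuously differentiable with derivative bounded uniformly in $t\in[0,T]$ for $j=1,\dots,d$. Then there exists a constant $\tilde C>0$ such that for all $t\in[0,T]$ and $\Delta t\in[0,T-t]$, $$Q^t_{(\Delta t)}\psi(x)\le\exp(\tilde C\Delta t)\psi(x)\quad\text{for all }x\in H.$$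
   Context: **Admissible weight.** A function $\psi\colon H\to(0,\infty)$ is an admissible weight function if $\{x\in H:\psi(x)\le R\}$ is weak-$*$ (equivalently weakly) compact for all $R>0$. **Cubature.** A cubature formula on Wiener space of order $m\ge1$ for $d$-dimensional Brownian motion $(B^j)_{j=1,\dots,d}$ on $[0,1]$ consists of weights $\lambda_i>0$ and continuous paths of bounded variation $\omega^{(1)}_i=(\omega^{(1),j}_i)_{j=0,\dots,d}$ starting at $0$, $i=1,\dots,N$, with $\omega^{(1),0}_i(s)=s$, such that for all multi-indices $(j_1,\dots,j_k)\in\{0,\dots,d\}^k$, $k\ge0$, with $k+\#\{i:j_i=0\}\le m$, $$\mathbb{E}\Big[\int\cdots\int_{0\le s_1\le\dots\le s_k\le1}\circ dB^{j_1}_{s_1}\cdots\circ dB^{j_k}_{s_k}\Big]=\sum_{i=1}^N\lambda_i\int\cdots\int_{0\le s_1\le\dots\le s_k\le1}d\omega_i^{(1),j_1}(s_1)\cdots d\omega_i^{(1),j_k}(s_k),$$ where $B^0_t:=t$, $\circ dB^0_t:=dt$, and $\circ$ denotes Stratonovich integration (for $k=0$: $\sum_i\lambda_i=1$). For $\Delta t>0$ set on $[0,\Delta t]$: $\omega^{(\Delta t),0}_i(s)=s$ and $\omega^{(\Delta t),j}_i(s)=\sqrt{\Delta t}\,\omega^{(1),j}_i(s/\Delta t)$, $j=1,\dots,d$. The formula is *weakly symmetric* if $\sum_{i=1}^N\lambda_i\omega^{(\Delta t),j}_i(s)=0$ for all $s\in[0,\Delta t]$ and $j=1,\dots,d$.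 **Approximation operator.** For $t\in[0,T]$, $\Delta t\in[0,T-t]$, $x\in H$, let $X^{t,x}_s(\omega_i^{(\Delta t)})$, $s\in[0,\Delta t]$, denote the solution of $$dX^{t,x}_s(\omega^{(\Delta t)}_i)=\sum_{j=0}^dV_j(t+s,X^{t,x}_s(\omega^{(\Delta t)}_i))\,d\omega^{(\Delta t),j}_i(s),\quad X^{t,x}_0(\omega^{(\Delta t)}_i)=x,$$ and define $Q^t_{(\Delta t)}f(x):=\sum_{i=1}^N\lambda_if(X^{t,x}_{\Delta t}(\omega^{(\Delta t)}_i))$ for $f\colon H\to\mathbb{R}$ (with $Q^t_{(0)}f=f$). No differentiability of $V_j$ with respect to $t$ is assumed. *)

(* Defs.v *)
From HB Require Import structures.
From mathcomp Require Import all_boot all_order all_algebra.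
From mathcomp Require Import all_classical all_reals all_analysis.
Set Implicit Arguments.
Unset Strict Implicit.
Unset Printing Implicit Defensive.
Import Order.TTheory GRing.Theory Num.Theory.
Import numFieldNormedType.Exports.
Local Open Scope classical_set_scope.
Local Open Scope ring_scope.

(* A real Hilbert space is a complete normed space whose norm comes from an
   inner product. *)
Record is_inner_product (R : realType) (H : completeNormedModType R)
    (ip : H -> H -> R) : Prop := IsInnerProduct {
  ip_sym : forall x y, ip x y = ip y x;
  ip_linear : forall (a : R) x y z, ip (a *: x + y) z = a * ip x z + ip y z;
  ip_norm : forall x, `|x| ^+ 2 = ip x x }.

Definition separable (T : topologicalType) : Prop :=
  exists2 D : set T, countable D & dense D.

(* H is identified with its dual through ip, so the weak-* topology is the
   coarsest one making all maps ip ^~ y continuous, i.e. the topology of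
   pointwise convergence of x |-> ip x. *)
Definition weak_star (R : realType) (H : completeNormedModType R)
    (ip : H -> H -> R) : topologicalType :=
  initial_topology ((fun x : H => ip x) : H -> {ptws H -> R}).

Definition admissible_weight (R : realType) (H : completeNormedModType R)
    (ip : H -> H -> R) (psi : H -> R) : Prop :=
  (forall x, 0 < psi x) /\
  forall K : R, 0 < K -> @compact (weak_star ip) [set x : H | psi x <= K].

Definition opnorm (R : realType) (U W : normedModType R) (L : U -> W) : \bar R :=
  ereal_sup [set `|L h|%:E | h in [set h : U | `|h| <= 1]].

Definition opnorm2 (R : realType) (U W : normedModType R) (L : U -> U -> W) :
  \bar R := ereal_sup [set opnorm (L h) | h in [set h : U | `|h| <= 1]].

(* f is twice Frechet differentiable at x: the map y |-> 'd f y is Frechet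
   differentiable at x for the operator norm, with derivative
   h |-> L h (bilinear and bounded). *)
Record is_diff2 (R : realType) (U W : normedModType R) (f : U -> W) (x : U)
    (L : U -> U -> W) : Prop := IsDiff2 {
  diff2_near : \forall y \near x, differentiable f y;
  diff2_linearl : forall (a : R) h h' k, L (a *: h + h') k = a *: L h k + L h' k;
  diff2_linearr : forall (a : R) h k k', L h (a *: k + k') = a *: L h k + L h k';
  diff2_bounded : (opnorm2 L < +oo)%E;
  diff2_approx : forall e : R, 0 < e -> \forall h \near (0 : U),
    (opnorm (fun k : U =>
       (('d f (x + h) : U -> W) k - ('d f x : U -> W) k - L h k)%R)
     <= (e * `|h|)%:E)%E }.

(* Lebesgue-Stieltjes integral over ]a, b] against an integrator g of bounded
   variation, written on [a, b] as a difference of nondecreasing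
   right-continuous functions; the value does not depend on the decomposition. *)
Definition is_stieltjes (R : realType) (g : R -> R) (a b : R) (f : R -> R)
    (v : R) : Prop :=
  exists g1 g2 : cumulative R R,
    [/\ forall r, a <= r <= b -> g r = g1 r - g2 r,
        (lebesgue_stieltjes_measure g1).-integrable `]a, b] (EFin \o f),
        (lebesgue_stieltjes_measure g2).-integrable `]a, b] (EFin \o f) &
        v = \int[lebesgue_stieltjes_measure g1]_(r in `]a, b]) f r
          - \int[lebesgue_stieltjes_measure g2]_(r in `]a, b]) f r].

Definition stieltjes (R : realType) (g : R -> R) (a b : R) (f : R -> R) : R :=
  xget 0 [set v | is_stieltjes g a b f v].

(* H-valued integral in the sense of Pettis; for separable H and bounded F it
   is the Bochner integral. *)
Definition is_stieltjesH (R : realType) (H : completeNormedModType R)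
    (ip : H -> H -> R) (g : R -> R) (a b : R) (F : R -> H) (J : H) : Prop :=
  forall h : H, is_stieltjes g a b (fun r => ip (F r) h) (ip J h).

(* Multi-index given last entry first, as the last integrator is outermost. *)
Fixpoint iter_path_rev (R : realType) (d : nat) (w : 'I_d.+1 -> R -> R)
    (js : seq 'I_d.+1) (t : R) : R :=
  if js is j :: js' then stieltjes (w j) 0 t (iter_path_rev w js') else 1.

Definition iter_path (R : realType) (d : nat) (w : 'I_d.+1 -> R -> R)
    (js : seq 'I_d.+1) (t : R) : R := iter_path_rev w (rev js) t.

Definition mutually_independent (disp : measure_display)
    (Omega : measurableType disp) (R : realType) (P : probability Omega R)
    (I : finType) (X : I -> Omega -> R) : Prop :=
  forall A : I -> set R, (forall i, measurable (A i)) ->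
    P (\bigcap_(i in [set: I]) (X i @^-1` A i)) =
    (\prod_(i : I) P (X i @^-1` A i))%E.

Record is_brownian_motion (disp : measure_display)
    (Omega : measurableType disp) (R : realType) (P : probability Omega R)
    (d : nat) (B : 'I_d -> R -> Omega -> R) : Prop := IsBrownianMotion {
  bm_measurable : forall j t, 0 <= t <= 1 -> measurable_fun setT (B j t);
  bm_start : forall j, {ae P, forall o, B j 0 o = 0};
  bm_gauss : forall j s t, 0 <= s -> s < t -> t <= 1 ->
    forall A : set R, measurable A ->
    P ((fun o => B j t o - B j s o) @^-1` A) = normal_prob 0 (Num.sqrt (t - s)) A;
  bm_indep : forall (n : nat) (t : nat -> R),
    0 <= t 0%N -> (forall k, (k < n)%N -> t k <= t k.+1) -> t n <= 1 ->
    mutually_independent P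
      (fun (p : 'I_d * 'I_n) o => B p.1 (t p.2.+1) o - B p.1 (t p.2) o);
  bm_continuous : forall j,
    {ae P, forall o, {within `[0, 1], continuous (fun t => B j t o)}} }.

(* Index 0 is time; index j > 0 is the j-th Brownian component. *)
Definition with_time (Omega : Type) (R : realType) (d : nat)
    (B : 'I_d -> R -> Omega -> R) (j : 'I_d.+1) (t : R) (o : Omega) : R :=
  if unlift ord0 j is Some k then B k t o else t.

Definition trapezoid (R : realType) (Y Z : R -> R) (a : R) (s : seq R) : R :=
  let p k := nth a (a :: s) k in
  \sum_(k < size s) (Y (p k) + Y (p k.+1)) / 2 * (Z (p k.+1) - Z (p k)).

(* Stratonovich integral of Y against Z over [0, t]: limit in probability of
   the trapezoidal sums as the mesh of the partition tends to 0. *)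
Definition is_stratonovich (disp : measure_display)
    (Omega : measurableType disp) (R : realType) (P : probability Omega R)
    (Y Z : R -> Omega -> R) (t : R) (J : Omega -> R) : Prop :=
  measurable_fun setT J /\
  forall e : R, 0 < e -> exists2 delta : R, 0 < delta &
    forall s : seq R, itv_partition 0 t s ->
      (forall k, (k < size s)%N -> nth 0 (0 :: s) k.+1 - nth 0 (0 :: s) k < delta) ->
      (P [set o : Omega | (e <= `|trapezoid (Y ^~ o) (Z ^~ o) 0 s - J o|)%R]
         <= e%:E)%E.

Definition stratonovich (disp : measure_display)
    (Omega : measurableType disp) (R : realType) (P : probability Omega R)
    (Y Z : R -> Omega -> R) (t : R) : Omega -> R :=
  xget (cst 0) [set J | is_stratonovich P Y Z t J].

Fixpoint iter_strat_rev (disp : measure_display)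
    (Omega : measurableType disp) (R : realType) (P : probability Omega R)
    (d : nat) (W : 'I_d.+1 -> R -> Omega -> R) (js : seq 'I_d.+1) (t : R) :
    Omega -> R :=
  if js is j :: js' then stratonovich P (iter_strat_rev P W js') (W j) t
  else cst 1.

Definition iter_strat (disp : measure_display)
    (Omega : measurableType disp) (R : realType) (P : probability Omega R)
    (d : nat) (W : 'I_d.+1 -> R -> Omega -> R) (js : seq 'I_d.+1) (t : R) :
    Omega -> R := iter_strat_rev P W (rev js) t.

Record is_cubature (disp : measure_display) (Omega : measurableType disp)
    (R : realType) (P : probability Omega R) (d : nat)
    (B : 'I_d -> R -> Omega -> R) (m N : nat) (lam : 'I_N -> R)
    (w : 'I_N -> 'I_d.+1 -> R -> R) : Prop := IsCubature {
  cub_gt0 : forall i, 0 < lam i;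
  cub_continuous : forall i j, {within `[0, 1], continuous (w i j)};
  cub_bv : forall i j, bounded_variation 0 1 (w i j);
  cub_start : forall i j, w i j 0 = 0;
  cub_time : forall i s, 0 <= s <= 1 -> w i ord0 s = s;
  cub_moment : forall js : seq 'I_d.+1,
    (size js + count_mem ord0 js <= m)%N ->
    ('E_P[iter_strat P (with_time B) js 1])%E =
    (\sum_(i < N) lam i * iter_path (w i) js 1)%:E }.

Definition scaled_path (R : realType) (d : nat) (w : 'I_d.+1 -> R -> R)
    (dt : R) (j : 'I_d.+1) (s : R) : R :=
  if j == ord0 then s else Num.sqrt dt * w j (s / dt).

Definition weakly_symmetric (R : realType) (d N : nat) (lam : 'I_N -> R)
    (w : 'I_N -> 'I_d.+1 -> R -> R) : Prop :=
  forall dt s : R, 0 < dt -> 0 <= s <= dt -> forall j : 'I_d.+1, j != ord0 ->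
    \sum_(i < N) lam i * scaled_path (w i) dt j s = 0.

(* Y solves dY_s = \sum_j V_j(t + s, Y_s) dw^j(s) on [0, dt], Y_0 = x. *)
Record is_solution (R : realType) (H : completeNormedModType R)
    (ip : H -> H -> R) (d : nat) (V : 'I_d.+1 -> R -> H -> H) (t dt : R) (x : H)
    (w : 'I_d.+1 -> R -> R) (Y : R -> H) : Prop := IsSolution {
  sol_continuous : {within `[0, dt], continuous Y};
  sol_start : Y 0 = x;
  sol_eq : forall s, 0 <= s <= dt -> exists2 J : 'I_d.+1 -> H,
    forall j, is_stieltjesH ip (w j) 0 s (fun r => V j (t + r) (Y r)) (J j) &
    Y s = x + \sum_(j < d.+1) J j }.

(* X t dt x i is the solution started from x at time t along the i-th path
   scaled to [0, dt]. *)
Definition Qop (R : realType) (H : Type) (N : nat) (lam : 'I_N -> R)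
    (X : R -> R -> H -> 'I_N -> R -> H) (t dt : R) (f : H -> R) (x : H) : R :=
  if dt == 0 then f x else \sum_(i < N) lam i * f (X t dt x i dt).

(* Main.v *)
Require Import Defs.
From HB Require Import structures.
From mathcomp Require Import all_boot all_order all_algebra.
From mathcomp Require Import all_classical all_reals all_analysis.
From mathcomp Require Import measurable_realfun ring lra.
Import Order.TTheory GRing.Theory Num.Theory.
Import numFieldNormedType.Exports.
Local Open Scope classical_set_scope.
Local Open Scope ring_scope.
Set Implicit Arguments.
Unset Strict Implicit.
Unset Printing Implicit Defensive.

(** Write <x> for sqrt (1 + |x|^2) and X^i for the solution started at x at
    time t and driven by the i-th path scaled to [0, dt].

    The scaled paths have total variation O(sqrt dt) on [0, dt], so the linear
    growth of the V_j gives |X^i_s - x| = O(<x> sqrt dt).  The hypotheses on psi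
    say that psi varies on the scale <x>: on the ball of radius <x>/2 around x
    it is at most e^C psi(x), and its second derivative is O(psi(x) / <x>^2).
    Hence, for small dt,

      psi (X^i_dt) <= psi x + Dpsi(x) (X^i_dt - x) + O(dt) psi x,

    and it remains to see that the first order term is O(dt) psi x after
    averaging over i.  Now X^i_dt - x is the sum over j of the integrals of
    V_j (t + r, X^i_r) against w_i^j.  The one with j = 0 is O(<x> dt).  For
    j > 0 replace X^i by X^k, where k is a fixed index: since V_j is Lipschitz
    this changes the integrand by O(<x> sqrt dt), hence the integral by
    O(<x> dt).  What is left has an integrand independent of i, and weak
    symmetry makes its average over i vanish.  Comparing with X^k rather than
    with the constant x keeps the argument free of any regularity in time: the
    integrand V_j (t + r, X^k_r) is measurable in r because X^k solves its
    equation, whereas the measurability of r |-> V_j (t + r, x) would have to be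
    derived separately.

    This settles the values of dt with c sqrt dt <= 1, for a certain constant
    c.  For the other ones, the path is cut into a bounded number of pieces on
    which the total variation is small; psi (X^i) grows by a factor at most e^C
    on each of them, and since dt is bounded below, the resulting constant is
    at most exp (c' dt) for c' large.

    The averaging argument is [weighted_stieltjes_le], applied in
    [averaged_increment_le]; the estimates on psi are [weight_segment_le],
    [weight_taylor] and [weight_average_le]; large dt is
    [weight_along_solution].  Vectors of H are bounded by testing them against
    the inner product ([norm_le_ip]), which is how the H-valued integrals are
    defined. *)

(** * Lebesgue-Stieltjes integrals of bounded functions *)

Lemma lebesgue_stieltjes_itv_oc (R : realType) (g : cumulative R R) (a b : R) :
  a <= b -> lebesgue_stieltjes_measure g `]a, b] = (g b - g a)%:E.
Proof.
move=> ab; rewrite /lebesgue_stieltjes_measure/= /measure_extension/=.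
rewrite measurable_mu_extE/=; last exact: is_ocitv.
by rewrite wlength_itv_bnd.
Qed.

Lemma bounded_integrable_stieltjes (R : realType) (g : cumulative R R)
    (a b M : R) (f : R -> R) : a <= b ->
  measurable_fun (`]a, b] : set (measurableTypeR R)) f ->
  (forall r, a < r <= b -> `|f r| <= M) ->
  (lebesgue_stieltjes_measure g).-integrable `]a, b] (EFin \o f).
Proof.
move=> ab mf fM.
apply: measurable_bounded_integrable => //.
- have := lebesgue_stieltjes_itv_oc g ab; rewrite /= => ->; exact: ltry.
- exists M; split; first exact: num_real.
  move=> x Mx r /=; rewrite in_itv/= => /fM/le_trans; apply; exact: ltW.
Qed.

(** Both sides are finite measures on the Borel sets of ]a, b] and they agree
    on the half-open intervals, which form a pi-system generating these sets. *)
Lemma eq_stieltjes_combination (R : realType) (n : nat) (l : nat -> {nonneg R})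
    (A B : nat -> cumulative R R) (a b : R) :
  (forall c d, a <= c -> c <= d -> d <= b ->
    \sum_(k < n) (l k)%:num * (A k d - A k c) =
    \sum_(k < n) (l k)%:num * (B k d - B k c)) ->
  forall E : set (measurableTypeR R), measurable E -> E `<=` `]a, b] ->
    msum (fun k => mscale (l k) (lebesgue_stieltjes_measure (A k))) n E =
    msum (fun k => mscale (l k) (lebesgue_stieltjes_measure (B k))) n E.
Proof.
move=> AB E mE Eab.
have mab : measurable (`]a, b] : set (measurableTypeR R)).
  exact: (@measurable_itv R).
pose mix (C : nat -> cumulative R R) :
    {measure set (measurableTypeR R) -> \bar R} :=
  msum (fun k => mscale (l k) (lebesgue_stieltjes_measure (C k))) n.
pose m1 : {measure set _ -> \bar R} := mrestr (mix A) mab.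
pose m2 : {measure set _ -> \bar R} := mrestr (mix B) mab.
suff : m1 E = m2 E by rewrite /m1 /m2 /mix /= /mrestr !(setIidl Eab).
have mixE (C : nat -> cumulative R R) c d : a <= c -> c <= d -> d <= b ->
    mix C `]c, d]%classic = (\sum_(k < n) (l k)%:num * (C k d - C k c))%:E.
  move=> ac cd db; rewrite /mix /= /msum -sumEFin; apply: eq_bigr => i _.
  by rewrite EFinM; congr (_ * _)%E; exact: lebesgue_stieltjes_itv_oc.
pose F (k : nat) : set (measurableTypeR R) := `](- k%:R), k%:R]%classic.
apply: (@measure_unique _ R (measurableTypeR R) (@ocitv R) F _ _ _ _ m1 m2);
  last exact: mE.
- by [].
- exact: ocitvI.
- by move=> k; exact: is_ocitv.
- apply/seteqP; split => //= x _ /=.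
  exists (Num.bound `|x : R|) => //; rewrite /F /= in_itv/=.
  have := archi_boundP (normr_ge0 (x : R)).
  by rewrite ltr_norml => /andP[-> /ltW].
- move=> _ [[c d] _ <-]/=. rewrite /mrestr.
  have -> : `]c, d] `&` `]a, b] = `]Num.max c a, Num.min d b]%classic.
    apply/seteqP; split => x /=; rewrite !in_itv/= gt_max le_min.
      by move=> [/andP[-> ->] /andP[-> ->]].
    by move=> /andP[/andP[-> ->] /andP[-> ->]].
  have [mM|Mm] := leP (Num.max c a) (Num.min d b).
    have aM : a <= Num.max c a by rewrite le_max lexx orbT.
    have mb : Num.min d b <= b by rewrite ge_min lexx orbT.
    by rewrite !mixE// AB.
  rewrite set_itv_ge ?bnd_simp -?leNgt ?ltW//.
  exact: etrans (measure0 (mix A)) (esym (measure0 (mix B))).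
- move=> k; rewrite /= /mrestr.
  have [ab|ba] := leP a b; last first.
    have -> : `]a, b]%classic = set0 :> set (measurableTypeR R).
      by rewrite set_itv_ge// bnd_simp -leNgt ltW.
    by rewrite setI0 (measure0 (mix A)).
  apply: (@le_lt_trans _ _ (mix A `]a, b]%classic)).
    apply: le_measure => //; rewrite ?inE//.
    apply: measurableI => //; exact: (@measurable_itv R).
  by rewrite mixE// ltry.
Qed.

(** Locked, so that integrals against different integrators are told apart
    without unfolding the underlying measures. *)
HB.lock Definition lsint (R : realType) (g : cumulative R R) (a b : R)
    (f : R -> R) : R :=
  \int[lebesgue_stieltjes_measure g]_(r in `]a, b]) f r.

Lemma is_stieltjesP (R : realType) (g : R -> R) (a b : R) (f : R -> R) (v : R) :
  is_stieltjes g a b f v -> exists g1 g2 : cumulative R R,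
    (forall r, a <= r <= b -> g r = g1 r - g2 r) /\
    v = lsint g1 a b f - lsint g2 a b f.
Proof.
by move=> [g1 [g2 [gE _ _ ->]]]; exists g1, g2; rewrite lsint.unlock.
Qed.

Lemma measurable_fun_shift (disp : measure_display) (T : measurableType disp)
    (R : realType) (D : set T) (f : T -> R) (M : R) :
  measurable_fun D f -> measurable_fun D (fun r => f r + M).
Proof. by move=> mf; apply: measurable_funD => //; exact: measurable_cst. Qed.

Lemma measurable_fun_sub (disp : measure_display) (T : measurableType disp)
    (R : realType) (D : set T) (f g : T -> R) :
  measurable_fun D f -> measurable_fun D g ->
  measurable_fun D (fun r => f r - g r).
Proof. by move=> mf mg; exact: measurable_funB. Qed.

(** Equality of the two mixtures of measures gives the claim for nonnegative
    integrands.  A signed f with |f| <= M is the difference of f + M and M,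
    which are both nonnegative and bounded. *)
Lemma eq_lsint_combination (R : realType) (n : nat)
    (l : nat -> {nonneg R}) (A B : nat -> cumulative R R) (a b M : R)
    (f : R -> R) : a <= b ->
  (forall c d, a <= c -> c <= d -> d <= b ->
    \sum_(k < n) (l k)%:num * (A k d - A k c) =
    \sum_(k < n) (l k)%:num * (B k d - B k c)) ->
  measurable_fun (`]a, b] : set (measurableTypeR R)) f ->
  (forall r, a < r <= b -> `|f r| <= M) ->
  \sum_(k < n) (l k)%:num * lsint (A k) a b f =
  \sum_(k < n) (l k)%:num * lsint (B k) a b f.
Proof.
move=> ab AB mf fM.
have mab : measurable (`]a, b] : set (measurableTypeR R)).
  exact: (@measurable_itv R).
pose S (C : nat -> cumulative R R) (g : R -> R) : R :=
  \sum_(k < n) (l k)%:num * lsint (C k) a b g.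
rewrite -[LHS]/(S A f) -[RHS]/(S B f).
have ge0E (g : R -> R) (K : R) :
    measurable_fun (`]a, b] : set (measurableTypeR R)) g ->
    (forall r, a < r <= b -> 0 <= g r <= K) -> forall C : nat -> cumulative R R,
    (S C g)%:E =
    (\int[msum (fun k => mscale (l k) (lebesgue_stieltjes_measure (C k))) n]_(r
       in (`]a, b] : set (measurableTypeR R))) (g r)%:E)%E.
  move=> mg gK C.
  have g0 (r : R) : `]a, b]%classic r -> (0 <= (g r)%:E)%E.
    by rewrite /= in_itv/= lee_fin => /gK/andP[].
  rewrite /S ge0_integral_measure_sum//; last exact/measurable_EFinP.
  rewrite -sumEFin; apply: eq_bigr => k _.
  rewrite ge0_integral_mscale//; last exact/measurable_EFinP.
  rewrite EFinM; congr (_ * _)%E.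
  rewrite lsint.unlock /Rintegral fineK//; apply: (integrable_fin_num mab).
  apply: (@bounded_integrable_stieltjes _ _ _ _ K) => // r /gK/andP[gr0 grK].
  by rewrite ger0_norm.
have ge0AB (g : R -> R) (K : R) :
    measurable_fun (`]a, b] : set (measurableTypeR R)) g ->
    (forall r, a < r <= b -> 0 <= g r <= K) -> S A g = S B g.
  move=> mg gK; apply: EFin_inj.
  apply: etrans (ge0E _ _ mg gK A) _; apply: etrans (esym (ge0E _ _ mg gK B)).
  apply: eq_measure_integral => E mE Eab; exact: (eq_stieltjes_combination AB).
have fMp r : a < r <= b -> 0 <= f r + M <= M + M.
  by move=> /fM; rewrite ler_norml => /andP[? ?]; apply/andP; split; lra.
have M0 r : a < r <= b -> 0 <= cst M r <= M.
  by move=> /fM fr; rewrite lexx andbT (le_trans _ fr).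
have decomp (C : nat -> cumulative R R) :
    S C f = S C (fun r => f r + M) - S C (cst M).
  rewrite /S -sumrB; apply: eq_bigr => k _; rewrite -mulrBr; congr (_ * _).
  rewrite lsint.unlock RintegralD ?addrK//.
    exact: (@bounded_integrable_stieltjes _ _ _ _ M).
  apply: (@bounded_integrable_stieltjes _ _ _ _ M) => // r /M0/andP[? ?].
  by rewrite ger0_norm.
have mfM : measurable_fun (`]a, b] : set (measurableTypeR R))
    (fun r => f r + M).
  exact: (measurable_fun_shift M mf).
have mM : measurable_fun (`]a, b] : set (measurableTypeR R)) (cst M).
  exact: (measurable_cst (D := (`]a, b] : set (measurableTypeR R))) M).
by rewrite (decomp A) (decomp B) (ge0AB _ _ mfM fMp) (ge0AB _ _ mM M0).
Qed.

Lemma norm_lsint_le (R : realType) (g : cumulative R R)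
    (a b M : R) (f : R -> R) : a <= b ->
  measurable_fun (`]a, b] : set (measurableTypeR R)) f ->
  (forall r, a < r <= b -> `|f r| <= M) ->
  `|lsint g a b f| <= M * (g b - g a).
Proof.
move=> ab mf fM; rewrite lsint.unlock.
have mab : measurable (`]a, b] : set (measurableTypeR R)).
  exact: (@measurable_itv R).
have intf := bounded_integrable_stieltjes g ab mf fM.
apply: (le_trans (le_normr_Rintegral mab intf)).
have -> : M * (g b - g a) =
    \int[lebesgue_stieltjes_measure g]_(r in `]a, b]) cst M r.
  rewrite Rintegral_cst//; congr (_ * _).
  have /(congr1 fine)/= := lebesgue_stieltjes_itv_oc g ab.
  by move=> /esym.
apply: le_Rintegral => //.
- apply: (@bounded_integrable_stieltjes _ _ _ _ M) => //.
    exact: measurableT_comp.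
  by move=> r /fM; rewrite normr_id.
- apply: (@bounded_integrable_stieltjes _ _ _ _ `|M|) => //.
Qed.

Lemma lsintB (R : realType) (g : cumulative R R) (a s t M : R) (f : R -> R) :
  a <= s -> s <= t ->
  measurable_fun (`]a, t] : set (measurableTypeR R)) f ->
  (forall r, a < r <= t -> `|f r| <= M) ->
  lsint g a t f - lsint g a s f = lsint g s t f.
Proof.
move=> as_ st mf fM; have at_ := le_trans as_ st.
have intf := bounded_integrable_stieltjes g at_ mf fM.
rewrite lsint.unlock.
have Eat : `]a, t]%classic = `]a, s] `|` `]s, t] :> set (measurableTypeR R).
  by rewrite -itv_bndbnd_setU// bnd_simp.
rewrite {1}Eat Rintegral_setU.
- by rewrite addrAC subrr add0r.
- exact: (@measurable_itv R).
- exact: (@measurable_itv R).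
- by rewrite -Eat.
- apply/disj_setPS => r [] /=; rewrite !in_itv/= => /andP[_ rs] /andP[sr _].
  by have := lt_le_trans sr rs; rewrite ltxx.
Qed.

Lemma lsintBf (R : realType) (g : cumulative R R) (a b M : R) (f1 f2 : R -> R) :
  a <= b ->
  measurable_fun (`]a, b] : set (measurableTypeR R)) f1 ->
  measurable_fun (`]a, b] : set (measurableTypeR R)) f2 ->
  (forall r, a < r <= b -> `|f1 r| <= M) ->
  (forall r, a < r <= b -> `|f2 r| <= M) ->
  lsint g a b f1 - lsint g a b f2 = lsint g a b (fun r => f1 r - f2 r).
Proof.
move=> ab mf1 mf2 f1M f2M; rewrite lsint.unlock; apply/esym; apply: RintegralB.
- exact: (@measurable_itv R).
- exact: (bounded_integrable_stieltjes g ab mf1 f1M).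
- exact: (bounded_integrable_stieltjes g ab mf2 f2M).
Qed.

Lemma is_stieltjes_measurable (R : realType) (g : R -> R) (a b v : R)
    (f : R -> R) : is_stieltjes g a b f v ->
  measurable_fun (`]a, b] : set (measurableTypeR R)) f.
Proof.
move=> [g1 [g2 [_ int1 _ _]]]; apply/measurable_EFinP.
exact: (measurable_int _ int1).
Qed.

(** The value of the integral can be computed with any decomposition: if
    g = h1 - h2 = g1 - g2 then h1 + g2 = h2 + g1, and f, being bounded, is
    integrable against each of the four integrators.  This allows to use
    one decomposition of a path for all times and integrands. *)
Lemma is_stieltjesE (R : realType) (g : R -> R) (g1 g2 : cumulative R R)
    (a b M v : R) (f : R -> R) : a <= b ->
  (forall r, a <= r <= b -> g r = g1 r - g2 r) ->
  (forall r, a < r <= b -> `|f r| <= M) ->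
  is_stieltjes g a b f v ->
  v = lsint g1 a b f - lsint g2 a b f.
Proof.
move=> ab gE fM vf; have mf := is_stieltjes_measurable vf.
have [h1 [h2 [hE ->]]] := is_stieltjesP vf.
pose A := nth h1 [:: h1; g2]; pose B := nth h1 [:: h2; g1].
pose l (_ : nat) : {nonneg R} := NngNum (@ler01 R).
have AB c d : a <= c -> c <= d -> d <= b ->
    \sum_(k < 2) (l k)%:num * (A k d - A k c) =
    \sum_(k < 2) (l k)%:num * (B k d - B k c).
  move=> ac cd db; rewrite !big_ord_recl !big_ord0/= !mul1r !addr0.
  have ab_c : a <= c <= b by rewrite ac (le_trans cd).
  have ab_d : a <= d <= b by rewrite db (le_trans ac).
  by have := gE _ ab_c; have := gE _ ab_d; rewrite (hE _ ab_c) (hE _ ab_d); lra.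
have := eq_lsint_combination ab AB mf fM.
rewrite !big_ord_recl !big_ord0/= !mul1r !addr0; lra.
Qed.

Lemma is_stieltjes_le (R : realType) (g : R -> R) (g1 g2 : cumulative R R)
    (a b M v : R) (f : R -> R) : a <= b ->
  (forall r, a <= r <= b -> g r = g1 r - g2 r) ->
  (forall r, a < r <= b -> `|f r| <= M) ->
  is_stieltjes g a b f v ->
  `|v| <= M * ((g1 b - g1 a) + (g2 b - g2 a)).
Proof.
move=> ab gE fM vf; have mf := is_stieltjes_measurable vf.
rewrite (is_stieltjesE ab gE fM vf).
have := norm_lsint_le g1 ab mf fM; have := norm_lsint_le g2 ab mf fM.
rewrite mulrDr => /ler_normlP[? ?] /ler_normlP[? ?].
by apply/ler_normlP; split; lra.
Qed.

Lemma is_stieltjes_increment_le (R : realType) (g : R -> R)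
    (g1 g2 : cumulative R R) (a s t M K vs vt : R) (f : R -> R) :
  a <= s -> s <= t ->
  (forall r, a <= r <= t -> g r = g1 r - g2 r) ->
  (forall r, a < r <= t -> `|f r| <= M) ->
  (forall r, s < r <= t -> `|f r| <= K) ->
  is_stieltjes g a s f vs -> is_stieltjes g a t f vt ->
  `|vt - vs| <= K * ((g1 t - g1 s) + (g2 t - g2 s)).
Proof.
move=> as_ st gE fM fK svs svt.
have at_ := le_trans as_ st.
have mf := is_stieltjes_measurable svt.
have -> := is_stieltjesE at_ gE fM svt.
have -> : vs = lsint g1 a s f - lsint g2 a s f.
  apply: (is_stieltjesE (M := M) as_ _ _ svs) => r /andP[ar rs].
    by apply: gE; rewrite ar (le_trans rs).
  by apply: fM; rewrite ar (le_trans rs).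
have e1 := lsintB g1 as_ st mf fM; have e2 := lsintB g2 as_ st mf fM.
have mfs : measurable_fun (`]s, t] : set (measurableTypeR R)) f.
  apply: measurable_funS mf; first exact: (@measurable_itv R).
  by move=> r /=; rewrite !in_itv/= => /andP[sr ->]; rewrite (le_lt_trans as_).
have := norm_lsint_le g1 st mfs fK; have := norm_lsint_le g2 st mfs fK.
rewrite -e1 -e2 mulrDr => /ler_normlP[? ?] /ler_normlP[? ?].
by apply/ler_normlP; split; lra.
Qed.

(** The averaging principle behind weak symmetry: when the weighted mean of the
    paths vanishes, only the differences of the integrands matter, since an
    integrand common to all paths contributes nothing. *)
Lemma weighted_stieltjes_le (R : realType) (n : nat) (l : 'I_n.+1 -> R)
    (w : 'I_n.+1 -> R -> R) (A B : 'I_n.+1 -> cumulative R R) (a b M K : R)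
    (f : 'I_n.+1 -> R -> R) (v : 'I_n.+1 -> R) : a <= b ->
  (forall i, 0 <= l i) ->
  (forall i r, a <= r <= b -> w i r = A i r - B i r) ->
  (forall r, a <= r <= b -> \sum_(i < n.+1) l i * w i r = 0) ->
  (forall i r, a < r <= b -> `|f i r| <= M) ->
  (forall i i' r, a < r <= b -> `|f i r - f i' r| <= K) ->
  (forall i, is_stieltjes (w i) a b (f i) (v i)) ->
  `|\sum_(i < n.+1) l i * v i| <=
    K * \sum_(i < n.+1) l i * ((A i b - A i a) + (B i b - B i a)).
Proof.
move=> ab l0 wE lw0 fM fK fv.
have mf i := is_stieltjes_measurable (fv i).
pose A' (k : nat) := A (inord k); pose B' (k : nat) := B (inord k).
pose l' (k : nat) : {nonneg R} := NngNum (l0 (inord k)).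
have AB c d : a <= c -> c <= d -> d <= b ->
    \sum_(k < n.+1) (l' k)%:num * (A' k d - A' k c) =
    \sum_(k < n.+1) (l' k)%:num * (B' k d - B' k c).
  move=> ac cd db.
  have acb : a <= c <= b by rewrite ac (le_trans cd).
  have adb : a <= d <= b by rewrite db (le_trans ac).
  apply/eqP; rewrite -subr_eq0 -sumrB; apply/eqP.
  transitivity (\sum_(i < n.+1) (l i * w i d - l i * w i c)).
    by apply: eq_bigr => i _; rewrite /A' /B' /= inord_val !wE//; ring.
  by rewrite sumrB !lw0// subrr.
(* f ord0 serves as the integrand common to all paths; any index would do *)
have z : \sum_(i < n.+1) l i *
    (lsint (A i) a b (f ord0) - lsint (B i) a b (f ord0)) = 0.
  have := eq_lsint_combination ab AB (mf ord0) (fM ord0).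
  move=> /eqP; rewrite -subr_eq0 -sumrB => /eqP z; rewrite -[RHS]z.
  by apply: eq_bigr => i _; rewrite /A' /B' /= inord_val mulrBr.
rewrite -[X in `|X|]subr0 -{}[X in _ - X]z -sumrB mulr_sumr.
apply: (le_trans (ler_norm_sum _ _ _)); apply: ler_sum => i _.
rewrite -mulrBr normrM (ger0_norm (l0 i)) mulrCA; apply: ler_wpM2l => //.
rewrite (is_stieltjesE ab (wE i) (fM i) (fv i)).
have mfi : measurable_fun (`]a, b] : set (measurableTypeR R))
    (fun r => f i r - f ord0 r).
  exact: (measurable_fun_sub (mf i) (mf ord0)).
have sub (C : cumulative R R) :
    lsint C a b (f i) - lsint C a b (f ord0) =
    lsint C a b (fun r => f i r - f ord0 r).
  exact: (lsintBf C ab (mf i) (mf ord0) (fM i) (fM ord0)).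
have := norm_lsint_le (A i) ab mfi (fK i ord0).
have := norm_lsint_le (B i) ab mfi (fK i ord0).
rewrite -!sub mulrDr => /ler_normlP[? ?] /ler_normlP[? ?].
by apply/ler_normlP; split; lra.
Qed.

(** * Continuous paths of bounded variation *)

Lemma cumulative_of_continuous (R : realType) (f : R -> R) :
  {homo f : x y / x <= y} -> continuous f ->
  exists g : cumulative R R, forall r, g r = f r.
Proof.
move=> ndf cf.
by exists (HB.pack_for (cumulative R R) f
  (isCumulative.Build R _ R f ndf (right_continuousW cf))).
Qed.

(** Integrators are functions on the whole line, while the paths are given on
    [0, 1] only; composing with this retraction extends them. *)
Definition clamp01 (R : realType) (r : R) : R := Num.max 0 (Num.min r 1).

Lemma clamp01_itv (R : realType) (r : R) : 0 <= clamp01 r <= 1.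
Proof. by rewrite /clamp01 le_max lexx/= ge_max ler01/= ge_min lexx orbT. Qed.

Lemma clamp01_id (R : realType) (r : R) : 0 <= r <= 1 -> clamp01 r = r.
Proof.
by move=> /andP[r0 r1]; rewrite /clamp01 (min_idPl r1) (max_idPr r0).
Qed.

Lemma clamp01_le (R : realType) : {homo @clamp01 R : x y / x <= y}.
Proof.
move=> x y xy; rewrite /clamp01.
by rewrite ge_max !le_max lexx/= le_min !ge_min xy lexx !orbT.
Qed.

Lemma continuous_clamp01 (R : realType) (f : R -> R) :
  {within `[0, 1], continuous f} -> continuous (f \o @clamp01 R).
Proof.
move=> /subspace_continuousP cf y.
have cy : `[0, 1]%classic (clamp01 y) by rewrite /= in_itv/= clamp01_itv.
have cc : clamp01 r @[r --> y] --> clamp01 y.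
  apply: (@continuous_max _ _ (cst 0) (fun r : R => Num.min r 1)).
    exact: cvg_cst.
  apply: (@continuous_min _ _ id (cst 1)); [exact: cvg_id|exact: cvg_cst].
move=> P /= hP; have hP' := cc _ (cf _ cy _ hP).
apply: (@filterS _ (nbhs y) _ _ _ _ hP') => r /=; apply.
by rewrite in_itv/= clamp01_itv.
Qed.

(** The total variation function P is continuous and so is P - w; both are
    nondecreasing, because an increment of w is at most that of P. *)
Lemma bounded_variation_decomposition (R : realType) (w : R -> R) :
  {within `[0, 1], continuous w} -> bounded_variation 0 1 w ->
  exists p q : R -> R,
    [/\ {homo p : x y / x <= y}, {homo q : x y / x <= y}, continuous p,
        continuous q & forall r, 0 <= r <= 1 -> w r = p r - q r].
Proof.
move=> cw bw; pose P r := fine (total_variation 0 r w).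
have cP : {within `[0, 1], continuous P}.
  exact: (total_variation_continuous ltr01 cw bw).
have finP r : 0 <= r <= 1 -> total_variation 0 r w \is a fin_num.
  move=> /andP[r0 r1]; apply/bounded_variationP => //.
  exact: bounded_variationl bw.
have PD r s : 0 <= r -> r <= s -> s <= 1 -> `|w s - w r| <= P s - P r.
  move=> r0 rs s1; have s0 := le_trans r0 rs; have r1 := le_trans rs s1.
  have frs : total_variation r s w \is a fin_num.
    apply/bounded_variationP => //; apply: (bounded_variationr r0 rs).
    exact: (bounded_variationl s0 s1).
  rewrite -lee_fin (le_trans (total_variation_ge w rs))//.
  rewrite /P (total_variationD w r0 rs) fineD// ?finP ?r0//.
  by rewrite addrAC subrr add0r fineK.
exists (P \o @clamp01 R), ((P \- w) \o @clamp01 R); split.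
- move=> x y xy /=.
  have /andP[x0 _] := clamp01_itv x; have /andP[_ y1] := clamp01_itv y.
  by rewrite -subr_ge0 (le_trans _ (PD _ _ x0 (clamp01_le xy) y1)).
- move=> x y xy /=.
  have /andP[x0 _] := clamp01_itv x; have /andP[_ y1] := clamp01_itv y.
  by have := PD _ _ x0 (clamp01_le xy) y1; rewrite ler_norml => /andP[_]; lra.
- exact: continuous_clamp01.
- by apply: continuous_clamp01 => r; apply: continuousB; [exact: cP|exact: cw].
- by move=> r r01 /=; rewrite clamp01_id// opprB addrC subrK.
Qed.

(** Brownian scaling makes the variation of the components j > 0 on [0, dt]
    proportional to sqrt dt, while time itself has variation dt. *)
Lemma scaled_path_decomposition (R : realType) (d : nat)
    (w : 'I_d.+1 -> R -> R) :
  (forall j, {within `[0, 1], continuous (w j)}) ->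
  (forall j, bounded_variation 0 1 (w j)) ->
  exists2 L : R, 0 <= L & forall dt, 0 < dt ->
    exists A B : 'I_d.+1 -> cumulative R R,
    [/\ forall j r, 0 <= r <= dt -> scaled_path w dt j r = A j r - B j r,
        forall j, continuous (A j),
        forall j, continuous (B j),
        forall j, j != ord0 ->
          (A j dt - A j 0) + (B j dt - B j 0) <= L * Num.sqrt dt &
        (A ord0 dt - A ord0 0) + (B ord0 dt - B ord0 0) = dt].
Proof.
move=> cw bw.
have /choice[p hp] := fun j => bounded_variation_decomposition (cw j) (bw j).
have {hp} /choice[q hpq] := hp.
pose L j := p j 1 - p j 0 + (q j 1 - q j 0).
have L0 j : 0 <= L j.
  have [ndp ndq _ _ _] := hpq j.
  by rewrite addr_ge0// subr_ge0; [apply: ndp|apply: ndq].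
exists (\sum_j L j); first by apply: sumr_ge0 => j _.
move=> dt dt0.
have s0 : 0 <= Num.sqrt dt by exact: sqrtr_ge0.
pose a j (r : R) : R := if j == ord0 then r else Num.sqrt dt * p j (r / dt).
pose b j (r : R) : R := if j == ord0 then 0 else Num.sqrt dt * q j (r / dt).
have ndsc (g : R -> R) : {homo g : x y / x <= y} ->
    {homo (fun r => Num.sqrt dt * g (r / dt)) : x y / x <= y}.
  move=> ndg x y xy; apply: ler_wpM2l => //; apply: ndg.
  by rewrite ler_pM2r ?invr_gt0.
have cdiv : continuous (fun r : R => r / dt).
  by move=> x; apply: cvgM; [exact: cvg_id|exact: cvg_cst].
have csc (g : R -> R) : continuous g ->
    continuous (fun r : R => Num.sqrt dt * g (r / dt)).
  move=> cg x; apply: cvgM; first exact: cvg_cst.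
  exact: (continuous_comp (cdiv x) (cg _)).
have ca j : continuous (a j).
  rewrite /a; case: (j == ord0); first by move=> x; exact: cvg_id.
  by apply: csc; have [] := hpq j.
have cb j : continuous (b j).
  rewrite /b; case: (j == ord0); first by move=> x; exact: cvg_cst.
  by apply: csc; have [] := hpq j.
have nda j : {homo a j : x y / x <= y}.
  rewrite /a; case: (j == ord0) => //; apply: ndsc; by have [] := hpq j.
have ndb j : {homo b j : x y / x <= y}.
  rewrite /b; case: (j == ord0) => //; apply: ndsc; by have [] := hpq j.
have /choice[A hA] := fun j => cumulative_of_continuous (nda j) (ca j).
have /choice[B hB] := fun j => cumulative_of_continuous (ndb j) (cb j).
have AE j : (A j : R -> R) = a j by apply/funext => r; exact: hA.
have BE j : (B j : R -> R) = b j by apply/funext => r; exact: hB.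
have dtn : dt != 0 by rewrite gt_eqF.
exists A, B; split.
- move=> j r /andP[r0 rdt]; rewrite hA hB /a /b /scaled_path.
  case: ifP => _; first by rewrite subr0.
  have [_ _ _ _ ->] := hpq j; first by rewrite mulrBr.
  by rewrite divr_ge0 ?(ltW dt0)//= ler_pdivrMr// mul1r.
- by move=> j; rewrite AE.
- by move=> j; rewrite BE.
- move=> j j0; rewrite !hA !hB /a /b (negbTE j0) mul0r divff// -!mulrBr -mulrDr.
  rewrite mulrC; apply: ler_wpM2r => //.
  rewrite (bigD1 j)//= lerDl; apply: sumr_ge0 => k _; exact: L0.
- by rewrite !hA !hB /a /b eqxx !subr0 addr0.
Qed.

(** When the driving path is A - B, this is an intrinsic time: increments of
    the clock bound the total variation of the path. *)
Definition clock (R : realType) (d : nat) (A B : 'I_d.+1 -> cumulative R R)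
  (r : R) : R := \sum_j (A j r + B j r).

Lemma clock_le (R : realType) (d : nat) (A B : 'I_d.+1 -> cumulative R R) :
  {homo clock A B : r s / r <= s}.
Proof.
move=> r s rs; apply: ler_sum => j _.
by apply: lerD; apply: cumulative_is_nondecreasing.
Qed.

Lemma continuous_clock (R : realType) (d : nat)
    (A B : 'I_d.+1 -> cumulative R R) :
  (forall j, continuous (A j)) -> (forall j, continuous (B j)) ->
  continuous (clock A B).
Proof.
move=> cA cB r; rewrite /clock.
have -> : (fun r => \sum_j (A j r + B j r)) = \sum_j (fun r => A j r + B j r).
  by apply/funext => s; rewrite fct_sumE.
apply: (@big_ind _ (fun f : R -> R => {for r, continuous f})).
- exact: cvg_cst.
- by move=> f g cf cg; exact: cvgD.
- by move=> j _; apply: cvgD; [exact: cA|exact: cB].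
Qed.

Lemma clockB (R : realType) (d : nat) (A B : 'I_d.+1 -> cumulative R R)
    (r s : R) :
  clock A B s - clock A B r = \sum_j ((A j s - A j r) + (B j s - B j r)).
Proof. by rewrite /clock -sumrB; apply: eq_bigr => j _; ring. Qed.

(** * The inner product and the bracket *)

Lemma ipD (R : realType) (H : completeNormedModType R) (ip : H -> H -> R) :
  is_inner_product ip -> forall x y z, ip (x + y) z = ip x z + ip y z.
Proof.
by move=> hip x y z; rewrite -{1}[x]scale1r (ip_linear hip) mul1r.
Qed.

Lemma ipZ (R : realType) (H : completeNormedModType R) (ip : H -> H -> R) :
  is_inner_product ip -> forall a x z, ip (a *: x) z = a * ip x z.
Proof.
move=> hip a x z; have ip0 : ip 0 z = 0.
  by have := ip_linear hip 1 0 0 z; rewrite scaler0 addr0 mul1r; lra.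
by rewrite -[a *: x]addr0 (ip_linear hip) ip0 addr0.
Qed.

Lemma ipB (R : realType) (H : completeNormedModType R) (ip : H -> H -> R) :
  is_inner_product ip -> forall x y z, ip (x - y) z = ip x z - ip y z.
Proof. by move=> hip x y z; rewrite (ipD hip) -scaleN1r (ipZ hip) mulN1r. Qed.

Lemma ip_sum (R : realType) (H : completeNormedModType R) (ip : H -> H -> R) :
  is_inner_product ip -> forall (I : finType) (F : I -> H) z,
  ip (\sum_i F i) z = \sum_i ip (F i) z.
Proof.
move=> hip I F z; apply: (big_morph (ip ^~ z)) => [x y|]; first exact: ipD.
by rewrite -(scale0r 0) (ipZ hip) mul0r.
Qed.

(** Cauchy-Schwarz, from the nonnegativity of the squared norm of
    |y|^2 x - <x, y> y. *)
Lemma ip_lipschitz (R : realType) (H : completeNormedModType R)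
    (ip : H -> H -> R) : is_inner_product ip ->
  forall x y, `|ip x y| <= `|x| * `|y|.
Proof.
move=> hip x y.
have ipZr a u z : ip u (a *: z) = a * ip u z.
  by rewrite (ip_sym hip) (ipZ hip) (ip_sym hip).
have ipDr u v z : ip z (u + v) = ip z u + ip z v.
  by rewrite (ip_sym hip) (ipD hip) !(ip_sym hip _ z).
have [->|y0] := eqVneq y 0.
  by rewrite -(scale0r 0) ipZr mul0r scale0r !normr0 mulr0.
have ny : 0 < `|y| by rewrite normr_gt0.
rewrite -ler_sqr ?nnegrE ?mulr_ge0// -normrX ger0_norm ?sqr_ge0//.
have : 0 <= `| (`|y| ^+ 2) *: x - ip x y *: y| ^+ 2 by exact: sqr_ge0.
rewrite [X in 0 <= X](ip_norm hip) -scaleNr (ipD hip) !ipDr !(ipZ hip) !ipZr.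
rewrite -!(ip_norm hip) (ip_sym hip y x) => h.
have : 0 <= `|y| ^+ 2 * (`|x| ^+ 2 * `|y| ^+ 2 - ip x y ^+ 2) by lra.
by rewrite pmulr_rge0 ?exprn_gt0// exprMn; lra.
Qed.

(** The H-valued integrals are only defined through their inner products with
    fixed vectors; this turns bounds on those into bounds on the norm. *)
Lemma norm_le_ip (R : realType) (H : completeNormedModType R)
    (ip : H -> H -> R) : is_inner_product ip ->
  forall (u : H) (c : R), 0 <= c ->
    (forall h, `|ip u h| <= c * `|h|) -> `|u| <= c.
Proof.
move=> hip u c c0 huc; have [->|u0] := eqVneq u 0; first by rewrite normr0.
have nu : 0 < `|u| by rewrite normr_gt0.
rewrite -(ler_pM2r nu) -expr2 (ip_norm hip).
exact: le_trans (ler_norm _) (huc u).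
Qed.

(** The Japanese bracket <x>, the common scale of the vector fields and of the
    weight. *)
Definition bracket (R : realType) (H : normedModType R) (x : H) : R :=
  Num.sqrt (1 + `|x| ^+ 2).

Lemma bracket_sqr (R : realType) (H : normedModType R) (x : H) :
  bracket x ^+ 2 = 1 + `|x| ^+ 2.
Proof. by rewrite sqr_sqrtr// addr_ge0// sqr_ge0. Qed.

Lemma bracket_ge1 (R : realType) (H : normedModType R) (x : H) :
  1 <= bracket x.
Proof. by rewrite -[leLHS]sqrtr1 ler_wsqrtr// lerDl sqr_ge0. Qed.

Lemma bracket_gt0 (R : realType) (H : normedModType R) (x : H) : 0 < bracket x.
Proof. exact: lt_le_trans ltr01 (bracket_ge1 x). Qed.

(** The bracket is 1-Lipschitz, being the norm of (1, x) in R x H. *)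
Lemma bracket_le (R : realType) (H : normedModType R) (x y : H) :
  bracket x <= bracket y + `|x - y|.
Proof.
have b0 := ltW (bracket_gt0 y).
have yb : `|y| <= bracket y.
  by rewrite -ler_sqr ?nnegrE// bracket_sqr lerDr.
have xy : `|x| <= `|y| + `|x - y|.
  by have := ler_normD y (x - y); rewrite addrC subrK.
rewrite -ler_sqr ?nnegrE ?addr_ge0// ?(ltW (bracket_gt0 x))//.
rewrite sqrrD !bracket_sqr.
have : `|x| ^+ 2 <= (`|y| + `|x - y|) ^+ 2.
  by rewrite ler_sqr ?nnegrE ?addr_ge0.
rewrite sqrrD; have : `|y| * `|x - y| <= bracket y * `|x - y|.
  exact: ler_wpM2r.
lra.
Qed.

Lemma bracket_half (R : realType) (H : normedModType R) (x y : H) :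
  `|y - x| <= bracket x / 2 -> bracket x / 2 <= bracket y.
Proof. by move=> yx; have := bracket_le x y; rewrite distrC; lra. Qed.

Lemma inv_sqr_half (R : realType) (b z : R) :
  0 < b -> b / 2 <= z -> (z ^+ 2)^-1 <= 4 * b^-1 ^+ 2.
Proof.
move=> b0 bz; have b2 : 0 < b / 2 by rewrite divr_gt0.
have z0 := lt_le_trans b2 bz.
rewrite -[leLHS]mul1r ler_pdivrMr ?exprn_gt0//.
have e : 4 * b^-1 ^+ 2 * (b / 2) ^+ 2 = 1 by field; rewrite gt_eqF.
rewrite -[leLHS]e.
apply: ler_wpM2l; first by rewrite mulr_ge0// sqr_ge0.
by rewrite lerXn2r ?nnegrE ?(ltW b2) ?(ltW z0).
Qed.

Lemma continuous_bracket (R : realType) (H : normedModType R) :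
  continuous (@bracket R H).
Proof.
move=> x.
apply: (@continuous_comp _ _ _ (fun x : H => 1 + `|x| ^+ 2) (@Num.sqrt R)).
  apply: cvgD; first exact: cvg_cst.
  by apply: cvgM; apply: cvg_norm; exact: cvg_id.
exact: sqrt_continuous.
Qed.

Lemma within_continuous_bracket (R : realType) (H : normedModType R)
    (Y : R -> H) (a b : R) : {within `[a, b], continuous Y} ->
  {within `[a, b], continuous (fun r => bracket (Y r))}.
Proof.
move=> cY r; exact: (continuous_comp (cY r) (@continuous_bracket R H (Y r))).
Qed.

(** * Local bounds on solutions of driven equations *)

(** The bound M only guarantees that the integrands are bounded from time 0 on;
    the estimate itself involves their size K on ]s, s'] alone. *)
Lemma solution_increment_le (R : realType) (H : completeNormedModType R)
    (ip : H -> H -> R) (d : nat) (V : 'I_d.+1 -> R -> H -> H) (t dt : R)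
    (x : H) (w : 'I_d.+1 -> R -> R) (Y : R -> H)
    (A B : 'I_d.+1 -> cumulative R R) (M K s s' : R) :
  is_inner_product ip -> is_solution ip V t dt x w Y ->
  (forall j r, 0 <= r <= dt -> w j r = A j r - B j r) ->
  0 <= s -> s <= s' -> s' <= dt ->
  (forall j r, 0 < r <= s' -> `|V j (t + r) (Y r)| <= M) ->
  (forall j r, s < r <= s' -> `|V j (t + r) (Y r)| <= K) -> 0 <= K ->
  `|Y s' - Y s| <=
    K * \sum_j ((A j s' - A j s) + (B j s' - B j s)).
Proof.
move=> hip [cY Y0 eqY] wE s0 ss' s'dt VM VK K0.
have [|J' hJ' ->] := eqY s'; first by rewrite s'dt (le_trans s0).
have [|J hJ ->] := eqY s; first by rewrite s0 (le_trans ss').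
rewrite opprD addrACA subrr add0r -sumrB.
have nd0 j : 0 <= (A j s' - A j s) + (B j s' - B j s).
  by rewrite addr_ge0// subr_ge0; apply: cumulative_is_nondecreasing.
apply: (norm_le_ip hip).
  by rewrite mulr_ge0// sumr_ge0.
move=> h; rewrite (ip_sum hip) mulr_sumr mulr_suml.
apply: (le_trans (ler_norm_sum _ _ _)); apply: ler_sum => j _.
rewrite (ipB hip) mulrAC.
apply: (is_stieltjes_increment_le s0 ss' _ _ _ (hJ j h) (hJ' j h)).
- by move=> r /andP[r0 rs']; apply: wE; rewrite r0 (le_trans rs').
- move=> r rs'; apply: (le_trans (ip_lipschitz hip _ _)).
  by apply: ler_wpM2r (VM j r rs').
- move=> r rs'; apply: (le_trans (ip_lipschitz hip _ _)).
  by apply: ler_wpM2r (VK j r rs').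
Qed.

Lemma solution_increment_bracket (R : realType) (H : completeNormedModType R)
    (ip : H -> H -> R) (d : nat) (V : 'I_d.+1 -> R -> H -> H) (t dt c : R)
    (x : H) (w : 'I_d.+1 -> R -> R) (Y : R -> H)
    (A B : 'I_d.+1 -> cumulative R R) :
  is_inner_product ip -> is_solution ip V t dt x w Y ->
  (forall j r, 0 <= r <= dt -> w j r = A j r - B j r) ->
  0 <= c ->
  (forall j r y, 0 <= r <= dt -> `|V j (t + r) y| <= c * bracket y) ->
  forall s s' K, 0 <= s -> s <= s' -> s' <= dt ->
    (forall r, s <= r <= s' -> bracket (Y r) <= K) ->
    `|Y s' - Y s| <= c * K * (clock A B s' - clock A B s).
Proof.
move=> hip solY wE c0 Vc s s' K s0 ss' s'dt YK.
have s'0 := le_trans s0 ss'.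
have dt0 := le_trans s'0 s'dt.
have cY := within_continuous_bracket (sol_continuous solY).
have [m _ maxm] := EVT_max dt0 cY.
rewrite clockB.
apply: (solution_increment_le hip solY wE s0 ss' s'dt (M := c * bracket (Y m))).
- move=> j r /andP[r0 rs'].
  have rdt : 0 <= r <= dt by rewrite ltW//= (le_trans rs').
  by rewrite (le_trans (Vc j r (Y r) rdt))// ler_wpM2l// maxm// in_itv.
- move=> j r /andP[sr rs'].
  have rdt : 0 <= r <= dt.
    by rewrite (le_trans s0 (ltW sr))/= (le_trans rs').
  by rewrite (le_trans (Vc j r (Y r) rdt))// ler_wpM2l// YK// ltW.
- rewrite mulr_ge0// (le_trans (ltW (bracket_gt0 (Y s))))//.
  by rewrite YK// lexx.
Qed.

(** Gronwall's lemma on a piece so short that no iteration is needed.  At the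
    point m where the bracket is maximal on [s, s'], <Y m> <= <Y s> + <Y m> / 3,
    so that <Y m> <= 3/2 <Y s>; this is where the constant 3/2 comes from. *)
Lemma path_piece_le (R : realType) (H : normedModType R) (dt c : R)
    (Y : R -> H) (v : R -> R) (s s' : R) :
  {within `[0, dt], continuous Y} -> 0 <= c -> {homo v : x y / x <= y} ->
  (forall s s' K, 0 <= s -> s <= s' -> s' <= dt ->
    (forall r, s <= r <= s' -> bracket (Y r) <= K) ->
    `|Y s' - Y s| <= c * K * (v s' - v s)) ->
  0 <= s -> s <= s' -> s' <= dt -> c * (v s' - v s) <= 3^-1 ->
  forall r, s <= r <= s' ->
    `|Y r - Y s| <= c * (3 / 2 * bracket (Y s)) * (v s' - v s).
Proof.
move=> cY c0 ndv hinc s0 ss' s'dt small.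
have cYs : {within `[s, s'], continuous Y}.
  apply: continuous_subspaceW cY => r /=; rewrite !in_itv/= => /andP[sr rs'].
  by rewrite (le_trans s0)//= (le_trans rs').
have [m mss' maxm] := EVT_max ss' (within_continuous_bracket cYs).
have b_m r : s <= r <= s' -> bracket (Y r) <= bracket (Y m).
  by move=> rss'; apply: maxm; rewrite in_itv.
have bm0 := bracket_gt0 (Y m).
have step r : s <= r <= s' ->
    `|Y r - Y s| <= c * bracket (Y m) * (v s' - v s).
  move=> /andP[sr rs'].
  apply: (@le_trans _ _ (c * bracket (Y m) * (v r - v s))).
    apply: hinc => //; first exact: le_trans s'dt.
    by move=> u /andP[su ur]; apply: b_m; rewrite su (le_trans ur).
  apply: ler_wpM2l; first by rewrite mulr_ge0// ltW.
  by rewrite lerD2r ndv.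
have bm : bracket (Y m) <= 3 / 2 * bracket (Y s).
  have := bracket_le (Y m) (Y s).
  have : s <= m <= s' by move: mss'; rewrite in_itv.
  move=> /step.
  have : c * bracket (Y m) * (v s' - v s) <= bracket (Y m) * 3^-1.
    by rewrite -mulrA mulrCA ler_wpM2l// ltW.
  move=> ? ? ?; lra.
move=> r rss'; apply: (le_trans (step r rss')).
apply: ler_wpM2r; first by rewrite subr_ge0 ndv.
exact: ler_wpM2l.
Qed.

Lemma solution_piece_le (R : realType) (H : completeNormedModType R)
    (ip : H -> H -> R) (d : nat) (V : 'I_d.+1 -> R -> H -> H) (t dt c : R)
    (x : H) (w : 'I_d.+1 -> R -> R) (Y : R -> H)
    (A B : 'I_d.+1 -> cumulative R R) :
  is_inner_product ip -> is_solution ip V t dt x w Y ->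
  (forall j r, 0 <= r <= dt -> w j r = A j r - B j r) ->
  0 <= c ->
  (forall j r y, 0 <= r <= dt -> `|V j (t + r) y| <= c * bracket y) ->
  forall s s', 0 <= s -> s <= s' -> s' <= dt ->
    c * (clock A B s' - clock A B s) <= 3^-1 ->
    forall r, s <= r <= s' ->
      `|Y r - Y s| <=
        c * (3 / 2 * bracket (Y s)) * (clock A B s' - clock A B s).
Proof.
move=> hip solY wE c0 Vc s s'.
apply: (path_piece_le (sol_continuous solY) c0 (@clock_le _ _ A B)).
exact: (solution_increment_bracket hip solY wE c0 Vc).
Qed.

(** On a piece with c u <= 1/3, where u is the increment of the clock, a
    solution thus moves by at most half of its bracket. *)
Lemma half_bracket_of_small_clock (R : realType) (c b u : R) :
  0 < b -> c * u <= 3^-1 -> c * (3 / 2 * b) * u <= b / 2.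
Proof.
move=> b0 cu; rewrite mulrAC mulrA.
apply: (@le_trans _ _ (3^-1 * (3 / 2 * b))); last by lra.
by rewrite -mulrA ler_wpM2r// mulr_ge0 ?ltW.
Qed.

(** * Derivatives along segments *)

Lemma opnorm_le (R : realType) (U W : normedModType R) (L : U -> W) (c : R) :
  (forall a h, L (a *: h) = a *: L h) -> (opnorm L <= c%:E)%E ->
  forall k, `|L k| <= c * `|k|.
Proof.
move=> Lhom Lc k; have [->|k0] := eqVneq k 0.
  by rewrite -(scale0r 0) Lhom !scale0r !normr0 mulr0.
have nk : 0 < `|k| by rewrite normr_gt0.
have : (`|L (`|k|^-1 *: k)|%:E <= c%:E)%E.
  apply: le_trans Lc; apply: ereal_sup_ubound; exists (`|k|^-1 *: k) => //=.
  by rewrite normrZ normfV normr_id mulVf ?gt_eqF.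
rewrite lee_fin Lhom normrZ normfV normr_id mulrC ler_pdivrMr//.
Qed.

Lemma opnorm2_le (R : realType) (U W : normedModType R) (L : U -> U -> W)
    (c : R) :
  (forall a h h' k, L (a *: h + h') k = a *: L h k + L h' k) ->
  (forall a h k k', L h (a *: k + k') = a *: L h k + L h k') ->
  (opnorm2 L <= c%:E)%E -> forall h k, `|L h k| <= c * `|h| * `|k|.
Proof.
move=> Ll Lr Lc h k.
have L0 k' : L 0 k' = 0.
  by have := Ll (-1) 0 0 k'; rewrite scaler0 addr0 scaleN1r addNr.
have R0 h' : L h' 0 = 0.
  by have := Lr (-1) h' 0 0; rewrite scaler0 addr0 scaleN1r addNr.
have Lhl a h' k' : L (a *: h') k' = a *: L h' k'.
  by have := Ll a h' 0 k'; rewrite addr0 L0 addr0.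
have Lhr a h' k' : L h' (a *: k') = a *: L h' k'.
  by have := Lr a h' k' 0; rewrite addr0 R0 addr0.
have [->|h0] := eqVneq h 0; first by rewrite L0 !normr0 mulr0 mul0r.
have nh : 0 < `|h| by rewrite normr_gt0.
have : (opnorm (L (`|h|^-1 *: h)) <= c%:E)%E.
  apply: le_trans Lc; apply: ereal_sup_ubound; exists (`|h|^-1 *: h) => //=.
  by rewrite normrZ normfV normr_id mulVf ?gt_eqF.
move=> /(opnorm_le (fun a k' => Lhr a _ k'))/(_ k).
rewrite Lhl normrZ normfV normr_id mulrC ler_pdivrMr//.
by rewrite mulrAC.
Qed.

Lemma is_derive_along (R : realType) (U W : normedModType R) (f : U -> W)
    (x k : U) (r : R) : differentiable f (x + r *: k) ->
  is_derive r 1 (fun s : R => f (x + s *: k)) ('d f (x + r *: k) k).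
Proof.
move=> df; have dvf := diff_derivable (v := k) df.
(* both derivatives are limits of the same difference quotients *)
have E : (fun h : R => h^-1 *:
      (((fun s : R => f (x + s *: k)) \o shift r) (h *: 1) - f (x + r *: k))) =
    (fun h : R => h^-1 *:
      ((f \o shift (x + r *: k)) (h *: k) - f (x + r *: k))).
  apply/funext => h /=; congr (_ *: (f _ - _)).
  by rewrite [h *: 1]mulr1 scalerDl addrCA.
split; first by rewrite /derivable E; exact: dvf.
by rewrite /derive E -/(derive _ _ _) deriveE.
Qed.

Lemma segment_mean_value (R : realType) (phi dphi : R -> R) (b : R) :
  0 <= b -> (forall r : R, is_derive r (1 : R) phi (dphi r)) ->
  exists2 c, 0 <= c <= b & phi b - phi 0 = dphi c * b.
Proof.
move=> b0 dphiP.
have [] := @MVT_segment R phi dphi 0 b b0.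
  apply: derivable_within_continuous => r _.
  by have [] := dphiP r.
move=> c; rewrite in_itv/= subr0 => cb e; by exists c.
Qed.

Lemma is_derive_quotient (R : realType) (W : normedModType R) (g : R -> W)
    (r : R) (dg : W) :
  (forall e : R, 0 < e -> \forall h \near (0 : R),
     `|g (r + h) - g r - h *: dg| <= e * `|h|) ->
  is_derive r (1 : R) g dg.
Proof.
move=> hg.
have c : (h^-1 *: ((g \o shift r) (h *: (1 : R)) - g r) @[h --> 0^']) --> dg.
  apply/cvgrPdist_le => e e0; near=> h.
  have h0 : h != 0 by near: h; exact: nbhs_dnbhs_neq.
  rewrite /= [h *: 1]mulr1 [h + r]addrC -{1}(scalerK h0 dg) -scalerBr.
  rewrite normrZ normfV distrC mulrC ler_pdivrMr ?normr_gt0//.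
  by near: h; apply: nbhs_dnbhs; exact: hg.
split; first by apply: cvgP c.
by apply: cvg_lim c.
Unshelve. all: by end_near. Qed.

(** The expansion of the derivative of f at x + r k in the direction h k, tested
    on the vector k, has an error of at most e' |h k| |k| for small h; choosing
    e' = e / (|k|^2 + 1) makes this at most e |h|. *)
Lemma is_derive_diff_along (R : realType) (U : normedModType R)
    (f : U -> R^o) (x k : U) (L : U -> U -> U -> R^o) (r : R) :
  is_diff2 f (x + r *: k) (L (x + r *: k)) ->
  is_derive r (1 : R) (fun s : R => ('d f (x + s *: k) : U -> R^o) k : R)
    (L (x + r *: k) k k).
Proof.
set z := x + r *: k => hd; apply: is_derive_quotient => e e0.
have e'0 : 0 < e / (`|k| ^+ 2 + 1) by rewrite divr_gt0// ltr_wpDl// sqr_ge0.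
have Lh a : L z (a *: k) k = a *: L z k k.
  have L0 : L z 0 k = 0.
    have := diff2_linearl hd (-1) 0 0 k.
    by rewrite scaler0 addr0 scaleN1r addNr.
  by have := diff2_linearl hd a k 0 k; rewrite addr0 L0 addr0.
have Lhr a h k' : L z h (a *: k') = a *: L z h k'.
  have R0 : L z h 0 = 0.
    have := diff2_linearr hd (-1) h 0 0.
    by rewrite scaler0 addr0 scaleN1r addNr.
  by have := diff2_linearr hd a h k' 0; rewrite addr0 R0 addr0.
have ck : (h *: k @[h --> (0 : R)]) --> (0 : U).
  by rewrite -[X in _ --> X](scale0r k); apply: cvgZr_tmp; exact: cvg_id.
have : \forall h \near (0 : R), (opnorm (fun k' : U =>
       (('d f (z + h *: k) : U -> R^o) k' - ('d f z : U -> R^o) k' -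
         L z (h *: k) k')%R)
     <= (e / (`|k| ^+ 2 + 1) * `|h *: k|)%:E)%E.
  exact: ck (diff2_approx hd e'0).
apply: filterS => h /opnorm_le hk.
have {hk} := hk _ k; rewrite Lh.
rewrite /z -addrA -scalerDl => hk.
apply: (le_trans (hk _)).
  by move=> a h'; rewrite Lhr !scalerBr !linearZ.
rewrite normrZ -[leLHS]mulrA -[_ * `|k|]mulrA -expr2.
have nk : 0 <= `|k| ^+ 2 by exact: sqr_ge0.
rewrite -[leLHS]mulrA; apply: ler_wpM2l; first exact: ltW.
by rewrite mulrCA ler_piMr// ler_pdivrMl ?mulr1 ?ltr_wpDl// lerDl.
Qed.

Lemma is_derive_ip (R : realType) (H : completeNormedModType R)
    (ip : H -> H -> R) (g : R -> H) (r : R) (dg h : H) :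
  is_inner_product ip -> is_derive r (1 : R) g dg ->
  is_derive r (1 : R) (fun s : R => ip (g s) h) (ip dg h).
Proof.
move=> hip [dvg <-].
have ci (u : H) : ip v h @[v --> u] --> ip u h.
  apply/cvgrPdist_lt => e e0; near=> v.
  rewrite -(ipB hip) (le_lt_trans (ip_lipschitz hip _ _))//.
  have hp : 0 < `|h| + 1 by rewrite ltr_wpDl.
  apply: (@le_lt_trans _ _ (`|u - v| * (`|h| + 1))).
    by rewrite ler_wpM2l// lerDl.
  rewrite -ltr_pdivlMr//; near: v; apply: cvgr_dist_lt; first exact: cvg_id.
  exact: divr_gt0.
have E : (fun e : R => ip (e^-1 *: ((g \o shift r) (e *: (1 : R)) - g r)) h) =
  (fun e : R => e^-1 *: (((fun s : R => ip (g s) h) \o shift r) (e *: (1 : R))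
    - ip (g r) h)).
  by apply/funext => e /=; rewrite (ipZ hip) (ipB hip).
have c : ip (e^-1 *: ((g \o shift r) (e *: (1 : R)) - g r)) h @[e --> (0 : R)^']
    --> ip ('D_1 g r) h.
  exact: (@cvg_comp _ _ _ _ (fun u => ip u h) _ _ _ dvg (ci _)).
rewrite E in c.
split; first by apply: cvgP c.
by apply: cvg_lim c.
Unshelve. all: by end_near. Qed.

(** The mean value theorem is applied to the real function
    s |-> <f (z + s (y - z)), h>, for each test vector h. *)
Lemma lipschitz_of_diff (R : realType) (H : completeNormedModType R)
    (ip : H -> H -> R) (f : H -> H) (K : R) : is_inner_product ip ->
  (forall x, differentiable f x) ->
  (forall x, (opnorm ('d f x : H -> H) <= K%:E)%E) ->
  forall y z, `|f y - f z| <= K * `|y - z|.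
Proof.
move=> hip df dfK y z; set k := y - z.
have dfk x : `|('d f x : H -> H) k| <= K * `|k|.
  by apply: opnorm_le => // a h; rewrite linearZ.
apply: (norm_le_ip hip); first exact: le_trans (dfk z).
move=> h.
have dphi (s : R) : is_derive s (1 : R) (fun s : R => ip (f (z + s *: k)) h)
    (ip (('d f (z + s *: k) : H -> H) k) h).
  by apply: (is_derive_ip _ hip); exact: is_derive_along.
have [c _] := segment_mean_value ler01 dphi.
rewrite scale1r scale0r addr0 (addrC z) subrK mulr1 -(ipB hip) => ->.
by apply: (le_trans (ip_lipschitz hip _ _)); exact: ler_wpM2r.
Qed.

(** * Weights that vary on the scale of the bracket *)

Section weight.
Context (R : realType) (H : normedModType R).
Variables (psi : H -> R) (C : R).
Hypothesis C0 : 0 < C.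
Hypothesis psi0 : forall x, 0 < psi x.
Hypothesis psi_diff : forall x, differentiable (psi : H -> R^o) x.
Hypothesis Dpsi_le : forall x : H,
  (opnorm ('d (psi : H -> R^o) x : H -> R^o) <=
    (C * (bracket x)^-1 * psi x)%:E)%E.

Lemma weight_diff_le (x k : H) :
  `|('d (psi : H -> R^o) x : H -> R^o) k| <= C * (bracket x)^-1 * psi x * `|k|.
Proof. by apply: opnorm_le => // a h; rewrite linearZ. Qed.

(** Along the segment the bracket is at least <x>/2, so the logarithmic
    derivative of psi in the direction k is at most
    C |k| / (<x>/2) <= C. *)
Lemma weight_segment_le (x k : H) : `|k| <= bracket x / 2 ->
  forall r, 0 <= r <= 1 -> psi (x + r *: k) <= expR C * psi x.
Proof.
move=> kx r /andP[r0 r1].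
have b0 := bracket_gt0 x.
pose dpsi (s : R) : R := ('d (psi : H -> R^o) (x + s *: k) : H -> R^o) k.
have dphi (s : R) : is_derive s (1 : R) (fun s : R => ln (psi (x + s *: k)))
    ((psi (x + s *: k))^-1 * dpsi s).
  have d1 : is_derive s (1 : R) (fun s : R => psi (x + s *: k)) (dpsi s).
    exact: (@is_derive_along R H R^o psi x k s (psi_diff _)).
  have d2 := is_derive1_ln (psi0 (x + s *: k)).
  exact: is_derive1_comp.
have [c /andP[c0 cr]] := segment_mean_value r0 dphi.
rewrite scale0r addr0 => e.
have c1 := le_trans cr r1.
have hb : bracket x / 2 <= bracket (x + c *: k).
  apply: bracket_half; rewrite addrAC subrr add0r normrZ ger0_norm//.
  by rewrite (le_trans _ kx)// ler_piMl.
have := weight_diff_le (x + c *: k) k; rewrite -/(dpsi c) => hd.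
have hd' : (psi (x + c *: k))^-1 * dpsi c <= C.
  rewrite ler_pdivrMl ?psi0//.
  apply: (le_trans (ler_norm _)); apply: (le_trans hd).
  rewrite -mulrA [_ * C]mulrC -mulrA; apply: ler_wpM2l; first exact: ltW.
  rewrite mulrCA ler_piMr ?(ltW (psi0 _))//.
  rewrite ler_pdivrMl ?mulr1 ?bracket_gt0//.
  by rewrite (le_trans kx).
rewrite -[psi (x + r *: k)]lnK ?posrE// -[psi x]lnK ?posrE// -expRD ler_expR.
rewrite -lerBlDr e (le_trans (ler_wpM2r r0 hd'))//.
by rewrite ler_piMr// ltW.
Qed.

Variable D2psi : H -> H -> H -> R.
Hypothesis psi_diff2 : forall x, is_diff2 (psi : H -> R^o) x (D2psi x).
Hypothesis D2psi_le : forall x : H,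
  (opnorm2 (D2psi x : H -> H -> R^o) <=
    (C * (1 + `|x| ^+ 2)^-1 * psi x)%:E)%E.

(** The mean value theorem is used twice on the segment, first for psi and then
    for its derivative in the direction k.  At the intermediate point, the
    bracket is at least <x>/2 and psi at most e^C psi(x), which accounts for
    the constant 4 C e^C. *)
Lemma weight_taylor (x k : H) : `|k| <= bracket x / 2 ->
  psi (x + k) <= psi x + ('d (psi : H -> R^o) x : H -> R^o) k +
    4 * C * expR C * psi x * (bracket x)^-1 ^+ 2 * `|k| ^+ 2.
Proof.
move=> kx; have b0 := bracket_gt0 x.
pose dpsi (s : R) : R := ('d (psi : H -> R^o) (x + s *: k) : H -> R^o) k.
have dphi (s : R) :
    is_derive s (1 : R) (fun s : R => psi (x + s *: k)) (dpsi s).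
  exact: (@is_derive_along R H R^o psi x k s (psi_diff _)).
have [c /andP[c0 c1]] := segment_mean_value ler01 dphi.
rewrite scale1r scale0r addr0 mulr1 => e1.
have ddphi (s : R) : is_derive s (1 : R) dpsi (D2psi (x + s *: k) k k).
  exact: is_derive_diff_along.
have [b /andP[b0' bc]] := segment_mean_value c0 ddphi.
rewrite [dpsi 0]/dpsi scale0r addr0 => e2.
have hb : bracket x / 2 <= bracket (x + b *: k).
  apply: bracket_half; rewrite addrAC subrr add0r normrZ ger0_norm//.
  by rewrite (le_trans _ kx)// ler_piMl// (le_trans bc).
have : `|(D2psi (x + b *: k) k k : R^o)| <=
    C * (1 + `|x + b *: k| ^+ 2)^-1 * psi (x + b *: k) * `|k| * `|k|.
  apply: (opnorm2_le _ _ (D2psi_le _)).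
    exact: diff2_linearl (psi_diff2 _).
  exact: diff2_linearr (psi_diff2 _).
move=> hD.
have hq : C * (1 + `|x + b *: k| ^+ 2)^-1 * psi (x + b *: k) <=
    4 * C * expR C * psi x * (bracket x)^-1 ^+ 2.
  have hz : (1 + `|x + b *: k| ^+ 2)^-1 <= 4 * (bracket x)^-1 ^+ 2.
    by rewrite -bracket_sqr; exact: inv_sqr_half.
  have hp : psi (x + b *: k) <= expR C * psi x.
    by apply: weight_segment_le => //; rewrite b0' (le_trans bc).
  rewrite (_ : 4 * C * expR C * psi x * (bracket x)^-1 ^+ 2 =
    C * (4 * (bracket x)^-1 ^+ 2) * (expR C * psi x)); last by ring.
  apply: ler_pM => //; last by rewrite ler_wpM2l// ltW.
  - by rewrite mulr_ge0 ?(ltW C0)// invr_ge0 addr_ge0 ?sqr_ge0.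
  - exact: ltW.
have hDc : D2psi (x + b *: k) k k * c <= `|(D2psi (x + b *: k) k k : R^o)|.
  by rewrite (le_trans (ler_norm _))// normrM (ger0_norm c0) ler_piMr.
have hK := ler_wpM2r (sqr_ge0 `|k|) hq.
move: e1 e2 hD hDc hK; move: (dpsi c) (D2psi _ k k) ('d psi x k) => u1 u2 u3.
move: (C / _ * _) (4 * C * _ * _ * _) => q Q; rewrite expr2 !mulrA.
by move: (`|_ : R^o|) (u2 * c) (q * _ * _) (Q * _ * _) => *; lra.
Qed.

(** The linear term of the Taylor expansion is evaluated at the weighted mean of
    the displacements, which is much smaller than the individual ones: O(dt)
    instead of O(sqrt dt). *)
Lemma weight_average_le (n : nat) (lam : 'I_n -> R) (k : 'I_n -> H) (x : H)
    (dt D E : R) :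
  0 <= dt -> (forall i, 0 <= lam i) -> \sum_i lam i = 1 ->
  (forall i, `|k i| <= bracket x / 2) ->
  (forall i, `|k i| <= D * bracket x * Num.sqrt dt) ->
  `|\sum_i lam i *: k i| <= E * bracket x * dt ->
  \sum_i lam i * psi (x + k i) <=
    expR ((C * E + 4 * C * expR C * D ^+ 2) * dt) * psi x.
Proof.
move=> dt0 lam0 lam1 kx kD kE.
have b0 := bracket_gt0 x; have p0 := psi0 x.
have bn : bracket x != 0 by rewrite gt_eqF.
have s0 := sqrtr_ge0 dt.
pose Q := 4 * C * expR C * psi x * (bracket x)^-1 ^+ 2.
have Q0 : 0 <= Q.
  by rewrite !mulr_ge0 ?expR_ge0 ?exprn_ge0 ?invr_ge0// ltW.
have k2 i : Q * `|k i| ^+ 2 <= 4 * C * expR C * D ^+ 2 * dt * psi x.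
  apply: (@le_trans _ _ (Q * (D * bracket x * Num.sqrt dt) ^+ 2)).
    by apply: ler_wpM2l => //; rewrite lerXn2r ?nnegrE// (le_trans _ (kD i)).
  rewrite !exprMn (sqr_sqrtr dt0) /Q le_eqVlt; apply/orP; left; apply/eqP.
  by field.
have first : ('d (psi : H -> R^o) x : H -> R^o) (\sum_i lam i *: k i) <=
    C * E * dt * psi x.
  apply: (le_trans (ler_norm _)); apply: (le_trans (weight_diff_le x _)).
  apply: (@le_trans _ _ (C * (bracket x)^-1 * psi x * (E * bracket x * dt))).
    by apply: ler_wpM2l => //; rewrite !mulr_ge0 ?invr_ge0// ltW.
  by rewrite le_eqVlt; apply/orP; left; apply/eqP; field.
apply: (@le_trans _ _
  ((1 + (C * E + 4 * C * expR C * D ^+ 2) * dt) * psi x)); last first.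
  by apply: ler_wpM2r; [exact: ltW|exact: expR_ge1Dx].
apply: (@le_trans _ _
  (\sum_i lam i * (psi x + 4 * C * expR C * D ^+ 2 * dt * psi x) +
    ('d (psi : H -> R^o) x : H -> R^o) (\sum_i lam i *: k i))).
  have -> : ('d (psi : H -> R^o) x : H -> R^o) (\sum_i lam i *: k i) =
      \sum_i lam i * ('d (psi : H -> R^o) x : H -> R^o) (k i).
    by rewrite linear_sum; apply: eq_bigr => i _; rewrite linearZ.
  rewrite -big_split/=; apply: ler_sum => i _; rewrite -mulrDr.
  apply: ler_wpM2l => //; apply: (le_trans (weight_taylor (kx i))).
  by rewrite addrAC lerD2r lerD2l.
rewrite -mulr_suml lam1 mul1r.
apply: (le_trans (lerD (lexx _) first)).
by rewrite le_eqVlt; apply/orP; left; apply/eqP; ring.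
Qed.

End weight.

(** By continuity of v, the interval can be cut where v has grown by exactly
    (n + 1) eta. *)
Lemma growth_by_pieces (R : realType) (dt eta a : R) (F v : R -> R) :
  0 < eta -> 1 <= a -> 0 <= F 0 -> continuous v -> {homo v : x y / x <= y} ->
  (forall s s', 0 <= s -> s <= s' -> s' <= dt -> v s' - v s <= eta ->
     F s' <= a * F s) ->
  forall n s, 0 <= s -> s <= dt -> v s - v 0 <= n.+1%:R * eta ->
    F s <= a ^+ n.+1 * F 0.
Proof.
move=> eta0 a1 F0 cv ndv step; elim=> [|n IH] s s0 sdt vs.
  by rewrite expr1; apply: step => //; rewrite mul1r in vs.
have an0 : 0 <= a ^+ n.+1 * F 0.
  by rewrite mulr_ge0// exprn_ge0// (le_trans ler01).
have [vsn|vsn] := leP (v s - v 0) (n.+1%:R * eta).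
  apply: (le_trans (IH s s0 sdt vsn)).
  by rewrite [in leRHS]exprS -mulrA ler_peMl.
have v0s : v 0 <= v s by exact: ndv.
have [m] : exists2 m, m \in `[0, s]%R & v m = v 0 + n.+1%:R * eta.
  apply: IVT => //; first exact: continuous_subspaceT.
  rewrite (min_idPl v0s) (max_idPr v0s) lerDl mulr_ge0//= ?(ltW eta0)//.
  by rewrite -lerBrDl ltW.
rewrite in_itv/= => /andP[m0 ms] vm.
apply: (@le_trans _ _ (a * F m)).
  apply: step => //; rewrite vm; move: vs.
  by rewrite -[n.+2]addn1 natrD mulrDl mul1r; lra.
rewrite exprS -mulrA; apply: ler_wpM2l; first exact: le_trans a1.
by apply: IH => //; [exact: le_trans sdt|rewrite vm addrAC subrr add0r].
Qed.

(** The clock increment allowed for a piece, 1/(3 c), is the one for which the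
    solution stays within half of its bracket, where psi changes by a factor at
    most e^C. *)
Lemma weight_along_solution (R : realType) (H : completeNormedModType R)
    (ip : H -> H -> R) (d : nat) (V : 'I_d.+1 -> R -> H -> H) (t dt c : R)
    (x : H) (w : 'I_d.+1 -> R -> R) (Y : R -> H)
    (A B : 'I_d.+1 -> cumulative R R) (psi : H -> R) (C : R) (n : nat) :
  is_inner_product ip -> is_solution ip V t dt x w Y -> 0 <= dt ->
  (forall j, continuous (A j)) -> (forall j, continuous (B j)) ->
  (forall j r, 0 <= r <= dt -> w j r = A j r - B j r) ->
  0 < c ->
  (forall j r y, 0 <= r <= dt -> `|V j (t + r) y| <= c * bracket y) ->
  0 < C -> (forall x, 0 < psi x) ->
  (forall x k, `|k| <= bracket x / 2 -> psi (x + k) <= expR C * psi x) ->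
  clock A B dt - clock A B 0 <= n.+1%:R * (3 * c)^-1 ->
  psi (Y dt) <= expR C ^+ n.+1 * psi x.
Proof.
move=> hip solY dt0 cA cB wE c0 Vc C0 psi0 psi_loc clockn.
rewrite -(sol_start solY).
apply: (@growth_by_pieces R dt (3 * c)^-1 (expR C) (psi \o Y)
  (clock A B)) => //.
- by rewrite invr_gt0 mulr_gt0.
- by rewrite -expR0 ler_expR ltW.
- exact/ltW/psi0.
- exact: continuous_clock.
- exact: clock_le.
move=> s s' s0 ss' s'dt hs /=; rewrite -[Y s'](subrK (Y s)) addrC.
apply: psi_loc.
have small : c * (clock A B s' - clock A B s) <= 3^-1.
  rewrite -ler_pdivlMl//; apply: (le_trans hs).
  by rewrite invfM mulrC.
apply: le_trans (half_bracket_of_small_clock (bracket_gt0 _) small).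
apply: (solution_piece_le hip solY wE (ltW c0) Vc) => //.
by rewrite ss' lexx.
Qed.

(** * Averaging over the driving paths *)

(** The component j = 0 of the increment is small because time has variation
    dt.  For j > 0, the integrands along two different paths differ by at most
    K |Y i r - Y i' r| = O(<x> sqrt dt), and [weighted_stieltjes_le] turns this
    into a bound O(<x> dt) on the weighted mean. *)
Lemma averaged_increment_le (R : realType) (H : completeNormedModType R)
    (ip : H -> H -> R) (d n : nat) (V : 'I_d.+1 -> R -> H -> H)
    (t dt c K L : R) (x : H) (lam : 'I_n.+1 -> R)
    (w : 'I_n.+1 -> 'I_d.+1 -> R -> R) (Y : 'I_n.+1 -> R -> H)
    (A B : 'I_n.+1 -> 'I_d.+1 -> cumulative R R) :
  is_inner_product ip -> 0 < dt ->
  (forall i, is_solution ip V t dt x (w i) (Y i)) ->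
  (forall i j r, 0 <= r <= dt -> w i j r = A i j r - B i j r) ->
  (forall i, 0 <= lam i) -> \sum_i lam i = 1 ->
  (forall j r, j != ord0 -> 0 <= r <= dt -> \sum_i lam i * w i j r = 0) ->
  0 <= c -> 0 <= K -> 0 <= L ->
  (forall j r y, 0 <= r <= dt -> `|V j (t + r) y| <= c * bracket y) ->
  (forall j r y z, j != ord0 -> 0 <= r <= dt ->
     `|V j (t + r) y - V j (t + r) z| <= K * `|y - z|) ->
  (forall i j, j != ord0 -> (A i j dt - A i j 0) + (B i j dt - B i j 0) <=
     L * Num.sqrt dt) ->
  (forall i, (A i ord0 dt - A i ord0 0) + (B i ord0 dt - B i ord0 0) <= dt) ->
  (forall i, clock (A i) (B i) dt - clock (A i) (B i) 0 <= L * Num.sqrt dt) ->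
  c * (L * Num.sqrt dt) <= 3^-1 ->
  `|\sum_i lam i *: (Y i dt - x)| <=
    d.+1%:R * (3 / 2 * c + 3 * K * c * L ^+ 2) * bracket x * dt.
Proof.
move=> hip dt0 solY wE lam0 lam1 lamw c0 K0 L0 Vc VK AB AB0 clockL small.
have dt0' := ltW dt0.
have b0 := bracket_gt0 x.
have s0 := sqrtr_ge0 dt.
have Yx i r : 0 <= r <= dt ->
    `|Y i r - x| <= c * (3 / 2 * bracket x) * (L * Num.sqrt dt).
  move=> rdt; rewrite -(sol_start (solY i)).
  apply: (@le_trans _ _ (c * (3 / 2 * bracket (Y i 0)) *
      (clock (A i) (B i) dt - clock (A i) (B i) 0))).
    apply: (solution_piece_le hip (solY i) (wE i) c0 Vc) => //.
    by apply: le_trans small; exact: ler_wpM2l.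
  apply: ler_wpM2l => //.
  by rewrite !mulr_ge0// ltW// bracket_gt0.
have bY i r : 0 <= r <= dt -> bracket (Y i r) <= 3 / 2 * bracket x.
  move=> rdt; apply: (le_trans (bracket_le _ x)).
  have := le_trans (Yx i r rdt) (half_bracket_of_small_clock b0 small); lra.
have VY i j r : 0 <= r <= dt ->
    `|V j (t + r) (Y i r)| <= c * (3 / 2 * bracket x).
  move=> rdt; apply: (le_trans (Vc j r _ rdt)); apply: ler_wpM2l => //.
  exact: bY.
have dtdt : 0 <= dt <= dt by rewrite dt0' lexx.
have /choice[J hJ] : forall i, exists J : 'I_d.+1 -> H,
    (forall j, is_stieltjesH ip (w i j) 0 dt
      (fun r => V j (t + r) (Y i r)) (J j)) /\
    Y i dt = x + \sum_(j < d.+1) J j.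
  by move=> i; have [J hJ ->] := sol_eq (solY i) dtdt; exists J.
have -> : \sum_i lam i *: (Y i dt - x) = \sum_j \sum_i lam i *: J i j.
  rewrite exchange_big/=; apply: eq_bigr => i _.
  by have [_ ->] := hJ i; rewrite addrAC subrr add0r scaler_sumr.
have lamsum (u : 'I_n.+1 -> R) (b : R) : (forall i, u i <= b) ->
    \sum_i lam i * u i <= b.
  move=> ub; rewrite -[leRHS]mul1r -lam1 mulr_suml; apply: ler_sum => i _.
  exact: ler_wpM2l.
pose E := (3 / 2 * c + 3 * K * c * L ^+ 2) * bracket x * dt.
have b0' := ltW b0; have L2 := sqr_ge0 L.
have E1 : 0 <= 3 / 2 * c * bracket x * dt by rewrite !mulr_ge0.
have E2 : 0 <= 3 * K * c * L ^+ 2 * bracket x * dt by rewrite !mulr_ge0.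
have EE : E = 3 / 2 * c * bracket x * dt + 3 * K * c * L ^+ 2 * bracket x * dt.
  by rewrite /E; ring.
have -> : d.+1%:R * (3 / 2 * c + 3 * K * c * L ^+ 2) * bracket x * dt =
    d.+1%:R * E by rewrite /E !mulrA.
apply: (@le_trans _ _ (\sum_(j < d.+1) E)); last first.
  by rewrite sumr_const card_ord mulr_natl.
apply: (le_trans (ler_norm_sum _ _ _)); apply: ler_sum => j _.
apply: (norm_le_ip hip); first by rewrite EE addr_ge0.
move=> h; rewrite (ip_sum hip).
have -> : \sum_i ip (lam i *: J i j) h = \sum_i lam i * ip (J i j) h.
  by apply: eq_bigr => i _; rewrite (ipZ hip).
have hV i r : 0 < r <= dt ->
    `|ip (V j (t + r) (Y i r)) h| <= c * (3 / 2 * bracket x) * `|h|.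
  move=> /andP[r0 rdt]; apply: (le_trans (ip_lipschitz hip _ _)).
  by apply: ler_wpM2r => //; apply: VY; rewrite ltW.
have [j0|j0] := eqVneq j ord0.
  apply: (le_trans (ler_norm_sum _ _ _)).
  apply: (@le_trans _ _ (3 / 2 * c * bracket x * dt * `|h|)); last first.
    by apply: ler_wpM2r => //; rewrite EE lerDl.
  under eq_bigr => i _ do rewrite normrM (ger0_norm (lam0 i)).
  apply: lamsum => i; have [hJi _] := hJ i.
  apply: (le_trans (is_stieltjes_le dt0' (wE i j) (hV i) (hJi j h))).
  have -> : 3 / 2 * c * bracket x * dt * `|h| =
      c * (3 / 2 * bracket x) * `|h| * dt.
    by ring.
  by rewrite j0; apply: ler_wpM2l => //; rewrite !mulr_ge0.
have hVV i i' r : 0 < r <= dt ->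
    `|ip (V j (t + r) (Y i r)) h - ip (V j (t + r) (Y i' r)) h| <=
    K * (2 * (c * (3 / 2 * bracket x) * (L * Num.sqrt dt))) * `|h|.
  move=> /andP[r0 rdt]; have rdt' : 0 <= r <= dt by rewrite ltW.
  rewrite -(ipB hip); apply: (le_trans (ip_lipschitz hip _ _)).
  apply: ler_wpM2r => //; apply: (le_trans (VK _ _ _ _ j0 rdt')).
  apply: ler_wpM2l => //.
  have -> : Y i r - Y i' r = (Y i r - x) - (Y i' r - x).
    by rewrite opprB addrA subrK.
  apply: (le_trans (ler_normB _ _)).
  by have := Yx i r rdt'; have := Yx i' r rdt'; lra.
have hS i : is_stieltjes (w i j) 0 dt (fun r => ip (V j (t + r) (Y i r)) h)
    (ip (J i j) h).
  by have [hJi _] := hJ i; exact: hJi.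
apply: (le_trans (weighted_stieltjes_le (w := fun i => w i j)
  (A := fun i => A i j) (B := fun i => B i j) dt0' lam0 (fun i => wE i j)
  (fun r => lamw j r j0) hV hVV hS)).
apply: (@le_trans _ _ (K * (2 * (c * (3 / 2 * bracket x) *
  (L * Num.sqrt dt))) * `|h| * (L * Num.sqrt dt))).
  apply: ler_wpM2l; first by rewrite !mulr_ge0// ltW.
  by apply: lamsum => i; exact: AB.
have -> : K * (2 * (c * (3 / 2 * bracket x) * (L * Num.sqrt dt))) * `|h| *
    (L * Num.sqrt dt) = 3 * K * c * L ^+ 2 * bracket x * (Num.sqrt dt ^+ 2) *
    `|h| by field.
by rewrite sqr_sqrtr//; apply: ler_wpM2r => //; rewrite EE lerDr.
Qed.

(** * The growth estimate *)

(** This is the moment condition of the empty multi-index. *)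
Lemma cubature_weights_sum (disp : measure_display)
    (Omega : measurableType disp) (R : realType) (P : probability Omega R)
    (d : nat) (B : 'I_d -> R -> Omega -> R)
    (m N : nat) (lam : 'I_N -> R) (w : 'I_N -> 'I_d.+1 -> R -> R) :
  is_cubature P B m lam w -> \sum_i lam i = 1.
Proof.
move=> hcub; have := cub_moment hcub (js := [::]) isT.
rewrite /iter_strat /= expectation_cst => -[->].
by apply: eq_bigr => i _; rewrite /iter_path /= mulr1.
Qed.

(** One constant L serves all paths and components.  Time has variation
    dt <= sqrt T sqrt dt, hence it fits the same bound. *)
Lemma cubature_decomposition (R : realType) (d n : nat)
    (w : 'I_n -> 'I_d.+1 -> R -> R) (T : R) : 0 < T ->
  (forall i j, {within `[0, 1], continuous (w i j)}) ->
  (forall i j, bounded_variation 0 1 (w i j)) ->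
  exists2 L : R, 0 < L & forall dt, 0 < dt -> dt <= T ->
    exists A B : 'I_n -> 'I_d.+1 -> cumulative R R,
    [/\ forall i j r, 0 <= r <= dt ->
          scaled_path (w i) dt j r = A i j r - B i j r,
        forall i j, continuous (A i j) /\ continuous (B i j),
        forall i j, (A i j dt - A i j 0) + (B i j dt - B i j 0) <=
          L * Num.sqrt dt,
        forall i,
          (A i ord0 dt - A i ord0 0) + (B i ord0 dt - B i ord0 0) <= dt &
        forall i, clock (A i) (B i) dt - clock (A i) (B i) 0 <=
          L * Num.sqrt dt].
Proof.
move=> T0 cw bw.
have /choice[l hl] : forall i, exists l, 0 <= l /\ forall dt, 0 < dt ->
    exists A B : 'I_d.+1 -> cumulative R R,
    [/\ forall j r, 0 <= r <= dt -> scaled_path (w i) dt j r = A j r - B j r,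
        forall j, continuous (A j),
        forall j, continuous (B j),
        forall j, j != ord0 ->
          (A j dt - A j 0) + (B j dt - B j 0) <= l * Num.sqrt dt &
        (A ord0 dt - A ord0 0) + (B ord0 dt - B ord0 0) = dt].
  move=> i; have [l l0 hl] := scaled_path_decomposition (cw i) (bw i).
  by exists l.
have sT : 0 < Num.sqrt T by rewrite sqrtr_gt0.
have sl : 0 <= \sum_i l i by apply: sumr_ge0 => i _; have [] := hl i.
pose L1 := Num.sqrt T + \sum_i l i.
have L10 : 0 < L1 by rewrite ltr_wpDr.
have d1 : 1 <= d.+1%:R :> R by rewrite ler1n.
exists (d.+1%:R * L1); first by rewrite mulr_gt0// (lt_le_trans ltr01).
move=> dt dt0 dtT.
have s0 := sqrtr_ge0 dt.
have /choice[A hA] := fun i => (hl i).2 dt dt0.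
have {hA} /choice[B hAB] := hA.
have AB1 i j : (A i j dt - A i j 0) + (B i j dt - B i j 0) <= L1 * Num.sqrt dt.
  have [_ _ _ hj h0] := hAB i; have [->|j0] := eqVneq j ord0.
    rewrite h0 -{1}(sqr_sqrtr (ltW dt0)) expr2; apply: ler_wpM2r => //.
    by apply: (@le_trans _ _ (Num.sqrt T)); [exact: ler_wsqrtr|rewrite lerDl].
  apply: (le_trans (hj j j0)); apply: ler_wpM2r => //.
  rewrite /L1 (bigD1 i)//= addrCA lerDl addr_ge0 ?(ltW sT)//.
  by apply: sumr_ge0 => k _; have [] := hl k.
exists A, B; split.
- by move=> i; have [] := hAB i.
- by move=> i j; have [_ cA cB _ _] := hAB i; split; [exact: cA|exact: cB].
- move=> i j; apply: (le_trans (AB1 i j)); apply: ler_wpM2r => //.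
  by rewrite ler_peMl// ltW.
- by move=> i; have [_ _ _ _ ->] := hAB i.
- move=> i; rewrite clockB -mulrA.
  apply: (@le_trans _ _ (\sum_(j < d.+1) L1 * Num.sqrt dt)).
    by apply: ler_sum => j _; exact: AB1.
  by rewrite sumr_const card_ord mulr_natl.
Qed.

Unset Implicit Arguments.

Theorem theorem4p4 (R : realType) (H : completeNormedModType R)
  (ip : H -> H -> R) (hip : is_inner_product ip) (hsep : separable H)
  (T : R) (hT : 0 < T) (d : nat) (V : 'I_d.+1 -> R -> H -> H)
  (disp : measure_display) (Omega : measurableType disp)
  (P : probability Omega R) (B : 'I_d -> R -> Omega -> R)
  (hB : is_brownian_motion P B)
  (m N : nat) (hm : (1 <= m)%N) (lam : 'I_N -> R) (w : 'I_N -> 'I_d.+1 -> R -> R)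
  (hcub : is_cubature P B m lam w) (hsym : weakly_symmetric lam w)
  (X : R -> R -> H -> 'I_N -> R -> H)
  (hX : forall t dt x i, 0 <= t <= T -> 0 < dt <= T - t ->
    is_solution ip V t dt x (scaled_path (w i) dt) (X t dt x i))
  (psi : H -> R) (hpsi : admissible_weight ip psi)
  (D2psi : H -> H -> H -> R) (hD2 : forall x, is_diff2 (psi : H -> R^o) x (D2psi x))
  (C : R) (hC : 0 < C)
  (hDpsi : forall x : H,
    (opnorm ('d (psi : H -> R^o) x : H -> R^o) <=
       (C * (Num.sqrt (1 + `|x| ^+ 2))^-1 * psi x)%:E)%E)
  (hD2psi : forall x : H,
    (opnorm2 (D2psi x : H -> H -> R^o) <= (C * (1 + `|x| ^+ 2)^-1 * psi x)%:E)%E)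
  (C' : R) (hC' : 0 < C')
  (hVgrowth : forall (j : 'I_d.+1) (x : H) (t : R), 0 <= t <= T ->
    `|V j t x| <= C' * Num.sqrt (1 + `|x| ^+ 2))
  (hVdiff : forall (j : 'I_d.+1) (t : R) (x : H), j != ord0 -> 0 <= t <= T ->
    differentiable (V j t) x)
  (hVC1 : forall (j : 'I_d.+1) (t : R) (x : H), j != ord0 -> 0 <= t <= T ->
    (fun y : H => opnorm (fun h : H =>
       ('d (V j t) y : H -> H) h - ('d (V j t) x : H -> H) h)) @ x --> 0%E)
  (hVbounded : forall j : 'I_d.+1, j != ord0 ->
    exists K : R, forall (t : R) (x : H), 0 <= t <= T ->
      (opnorm ('d (V j t) x : H -> H) <= K%:E)%E) :
  exists2 Ct : R, 0 < Ct &
    forall t dt : R, 0 <= t <= T -> 0 <= dt <= T - t ->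
      forall x : H, Qop lam X t dt psi x <= expR (Ct * dt) * psi x.
Proof.
have lam1 := cubature_weights_sum hcub.
case: N lam w hcub hsym X hX lam1 => [|n] lam w hcub hsym X hX lam1.
  by move/eqP: lam1; rewrite big_ord0 eq_sym oner_eq0.
have lam0 i : 0 <= lam i by exact/ltW/(cub_gt0 hcub).
have [psi0 _] := hpsi.
have psi_diff x : differentiable (psi : H -> R^o) x.
  exact: nbhs_singleton (diff2_near (hD2 x)).
have [L L0 hL] := cubature_decomposition hT (cub_continuous hcub) (cub_bv hcub).
have [K K0 VK] : exists2 K : R, 0 <= K &
    forall j t y z, j != ord0 -> 0 <= t <= T ->
    `|V j t y - V j t z| <= K * `|y - z|.
  have /choice[k hk] : forall j : 'I_d.+1, exists K : R, j != ord0 ->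
      forall (t : R) (x : H), 0 <= t <= T ->
      (opnorm ('d (V j t) x : H -> H) <= K%:E)%E.
    move=> j; have [->|j0] := eqVneq j ord0; first by exists 0.
    by have [K hK] := hVbounded j j0; exists K.
  exists (\sum_j `|k j|); first exact: sumr_ge0.
  move=> j t y z j0 tT.
  apply: (le_trans (lipschitz_of_diff hip (fun x => hVdiff j t x j0 tT)
    (fun x => hk j j0 t x tT) y z)).
  apply: ler_wpM2r => //; rewrite (bigD1 j)//= (le_trans (ler_norm _))//.
  by rewrite lerDl sumr_ge0.
pose E := d.+1%:R * (3 / 2 * C' + 3 * K * C' * L ^+ 2).
pose D := 3 / 2 * C' * L.
pose K1 := C * E + 4 * C * expR C * D ^+ 2.
have E0 : 0 <= E by rewrite !(mulr_ge0, addr_ge0) ?exprn_ge0// ltW.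
have K10 : 0 < K1.
  rewrite /K1 ltr_wpDl ?(mulr_ge0 (ltW hC) E0)//.
  by rewrite !mulr_gt0 ?expR_gt0 ?exprn_gt0 ?divr_gt0 ?mulr_gt0.
(* if the single-piece condition C' L sqrt dt <= 1/3 fails, then dt >= delta *)
pose delta := ((3 * C' * L)^-1) ^+ 2.
have delta0 : 0 < delta by rewrite exprn_gt0// invr_gt0 !mulr_gt0.
(* n1 + 1 pieces of length 1 / (3 C') suffice to exhaust the clock, whatever
   dt <= T is *)
pose n1 := Num.bound (L * Num.sqrt T * (3 * C')).
have n1P : L * Num.sqrt T <= n1.+1%:R * (3 * C')^-1.
  rewrite ler_pdivlMr ?mulr_gt0// ltW//.
  have : L * Num.sqrt T * (3 * C') < n1%:R.
    by apply: archi_boundP; rewrite !mulr_ge0 ?sqrtr_ge0// ltW.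
  by move/lt_le_trans; apply; rewrite ler_nat.
pose G := expR C ^+ n1.+1.
have G0 : 0 < G by rewrite exprn_gt0// expR_gt0.
exists (K1 + G / delta); first by rewrite addr_gt0// divr_gt0.
move=> t dt tT dtT x; rewrite /Qop; have [->|dtn0] := eqVneq dt 0.
  by rewrite mulr0 expR0 mul1r.
have dt0 : 0 < dt by move: dtT => /andP[? _]; rewrite lt_neqAle eq_sym dtn0.
have dtT' : 0 < dt <= T - t by move: dtT => /andP[_ ->]; rewrite dt0.
have tdt : t + dt <= T by move: dtT => /andP[_]; rewrite lerBrDl.
have dtleT : dt <= T.
  by move: tT => /andP[t0 _]; apply: le_trans tdt; rewrite lerDr.
have tr r : 0 <= r <= dt -> 0 <= t + r <= T.
  move: tT => /andP[t0 _] /andP[r0 rdt]; rewrite addr_ge0//=.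
  by apply: le_trans tdt; rewrite lerD2l.
have solX i := hX t dt x i tT dtT'.
have [A [B' [wE cAB AB AB0 clockL]]] := hL dt dt0 dtleT.
have Vc j r y : 0 <= r <= dt -> `|V j (t + r) y| <= C' * bracket y.
  by move=> /tr; exact: hVgrowth.
have s0 := sqrtr_ge0 dt.
have psi_ge0 := ltW (psi0 x).
have exp_mono (a : R) : a <= K1 + G / delta -> expR (a * dt) * psi x <=
    expR ((K1 + G / delta) * dt) * psi x.
  by move=> aK; rewrite ler_wpM2r// ler_expR ler_wpM2r// ltW.
have [small|large] := leP (C' * (L * Num.sqrt dt)) 3^-1.
  apply: (@le_trans _ _ (expR (K1 * dt) * psi x)); last first.
    by apply: exp_mono; rewrite lerDl divr_ge0// ltW.
  have kD i : `|X t dt x i dt - x| <= D * bracket x * Num.sqrt dt.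
    have hdt : 0 <= dt <= dt by rewrite lexx ltW.
    have smalli : C' * (clock (A i) (B' i) dt - clock (A i) (B' i) 0) <= 3^-1.
      by apply: le_trans small; rewrite ler_wpM2l// ltW.
    have := solution_piece_le hip (solX i) (wE i) (ltW hC') Vc (lexx 0)
      (ltW dt0) (lexx dt) smalli hdt.
    rewrite (sol_start (solX i)) => /le_trans; apply.
    apply: (@le_trans _ _ (C' * (3 / 2 * bracket x) * (L * Num.sqrt dt))).
      by rewrite ler_wpM2l// !mulr_ge0 ?invr_ge0// ltW// bracket_gt0.
    by rewrite le_eqVlt; apply/orP; left; apply/eqP; rewrite /D; ring.
  have kx i : `|X t dt x i dt - x| <= bracket x / 2.
    apply: (le_trans (kD i)).
    apply: le_trans (half_bracket_of_small_clock (bracket_gt0 x) small).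
    by rewrite le_eqVlt; apply/orP; left; apply/eqP; rewrite /D; ring.
  have kE : `|\sum_i lam i *: (X t dt x i dt - x)| <= E * bracket x * dt.
    apply: (averaged_increment_le hip dt0 solX wE lam0 lam1 _ (ltW hC') K0
      (ltW L0) Vc) => //.
    - by move=> j r j0 rdt; exact: hsym.
    - by move=> j r y z j0 /tr; exact: VK.
  have := weight_average_le hC psi0 psi_diff hDpsi hD2 hD2psi (ltW dt0) lam0
    lam1 kx kD kE.
  by under eq_bigr => i _ do rewrite (addrC x) subrK.
have dtdelta : delta <= dt.
  rewrite -(sqr_sqrtr (ltW dt0)).
  rewrite lerXn2r ?nnegrE ?invr_ge0 ?mulr_ge0 ?(ltW hC') ?(ltW L0)//.
  rewrite -[leLHS]mul1r ler_pdivrMr ?mulr_gt0//.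
  have -> : Num.sqrt dt * (3 * C' * L) = 3 * (C' * (L * Num.sqrt dt)) by ring.
  by rewrite -ler_pdivrMl// mulr1 ltW.
apply: (@le_trans _ _ (G * psi x)).
  rewrite -[leRHS]mul1r -lam1 mulr_suml; apply: ler_sum => i _.
  apply: ler_wpM2l => //.
  apply: (weight_along_solution hip (solX i) (ltW dt0) (fun j => (cAB i j).1)
    (fun j => (cAB i j).2) (wE i) hC' Vc hC psi0).
    move=> y k ky; have one01 : 0 <= (1 : R) <= 1 by rewrite ler01 lexx.
    have := weight_segment_le hC psi0 psi_diff hDpsi ky one01.
    by rewrite scale1r.
  apply: (le_trans (clockL i)); apply: le_trans n1P.
  by rewrite ler_wpM2l ?(ltW L0)// ler_wsqrtr.
apply: (@le_trans _ _ (expR (G / delta * dt) * psi x)).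
  apply: ler_wpM2r => //; apply: le_trans (expR_ge1Dx _).
  apply: (@le_trans _ _ (G / delta * dt)); last by rewrite lerDr.
  by rewrite -mulrA ler_peMr ?(ltW G0)// ler_pdivlMl ?mulr1.
by apply: exp_mono; rewrite lerDr ltW.
Qed.
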